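(* Let $k$ be an algebraically closed field of characteristic $0$, let $m,n\ge 1$ be integers, let $\mathfrak{g}=\mathfrak{gl}(m|n)$ and let $\mathfrak{p}\subseteq\mathfrak{g}$ be the distinguished parabolic subalgebra. Then the restriction map $$\operatorname{res}^{T(\mathfrak{g})}_{T(\mathfrak{p})}:T(\mathfrak{g})\to T(\mathfrak{p}),\qquad M\mapsto M|_{\mathfrak{p}},$$ between the groups of endotrivial supermodules is injective.
   Context: $\mathfrak{gl}(m|n)$ is the space of $(m+n)\times(m+n)$ matrices over $k$ with matrix units $e_{i,j}$; the even part consists of block diagonal matrices (blocks $m\times m$, $n\times n$), the odd part of block off-diagonal matrices, and $[X,Y]=XY-(-1)^{|X||Y|}YX$ for homogeneous $X,Y$. All modules are $\mathbb{Z}_2$-graded (supermodules). Distinguished parabolic $\mathfrak{p}$: $\mathfrak{p}_{\overline 0}$ consists of the pairs of upper triangular matrices in $\mathfrak{gl}(m)\oplus\mathfrak{gl}(n)$, and $\mathfrak{p}_{\overline 1}$ is spanned by the $e_{i,m+j}$ and the $e_{m+i,j}$ with $i\le j$ (with $1\le i\le m$, $1\le j\le n$ in the first case and $1\le i\le n$, $1\le j\le m$ in the second). Its maximal torus $\mathfrak{t}_{\overline 0}$ is the set of diagonal matrices. $\mathcal{F}_{(\mathfrak{g},\mathfrak{g}_{\overline 0})}$ is the category of finite dimensional $\mathfrak{g}$-supermodules completely reducible over $\mathfrak{g}_{\overline 0}$; $\mathcal{F}_{(\mathfrak{p},\mathfrak{p}_{\overline 0})}$ is the category of finite dimensional $\mathfrak{p}$-supermodules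 completely reducible over $\mathfrak{t}_{\overline 0}$; morphisms are the even module homomorphisms. For $\mathfrak{l}\in\{\mathfrak{g},\mathfrak{p}\}$ and $\mathcal{F}=\mathcal{F}_{(\mathfrak{l},\mathfrak{l}_{\overline 0})}$: a short exact sequence $0\to M_1\to M_2\xrightarrow{g} M_3\to 0$ of $U(\mathfrak{l})$-supermodules and even maps is $(U(\mathfrak{l}),U(\mathfrak{l}_{\overline 0}))$-exact if it splits as a sequence of $U(\mathfrak{l}_{\overline 0})$-supermodules. A supermodule $P$ is $(U(\mathfrak{l}),U(\mathfrak{l}_{\overline 0}))$-projective if for every such sequence every $\mathfrak{l}$-supermodule map $h:P\to M_3$ lifts to an $\mathfrak{l}$-supermodule map $\tilde h:P\to M_2$ with $g\circ\tilde h=h$. Projective modules in $\mathcal{F}$ are the objects of $\mathcal{F}$ that are $(U(\mathfrak{l}),U(\mathfrak{l}_{\overline 0}))$-projective. The stable module category $\operatorname{Stmod}(\mathcal{F})$ has the same objects as $\mathcal{F}$, with two morphisms $f,g$ identified when $f-g$ factors through a projective module in $\mathcal{F}$. Let $k_{ev}$ be the trivial module concentrated in degree $\overline 0$. Then $$T(\mathfrak{l})=\{[M]\in\operatorname{Stmod}(\mathcal{F}) : M\otimes M^*\cong k_{ev}\oplus P_M\text{ for some projective }P_M\text{ in }\mathcal{F}\},$$ the set of stable isomorphism classes of endotrivial modules, with operation $[M]+[N]=[M\otimes N]$. The restriction map above is a well defined group homomorphism. *)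

(* Defs.v *)
From HB Require Import structures.
From mathcomp Require Import all_boot all_order all_algebra.
From mathcomp Require Import ring.
From mathcomp Require Import boolp.

Set Implicit Arguments.
Unset Strict Implicit.
Unset Printing Implicit Defensive.

Import GRing.Theory.

Local Open Scope ring_scope.

(* The parity [Z/2] is [bool]: [false] is even, [true] is odd, [(+)] is the
   sum and [&&] is the product. *)

Section SubSuperalgebra.
Variables (k : fieldType) (m n : nat).
Implicit Types (p q : bool) (x y : 'M[k]_(m + n)).

Definition hpart p x : 'M[k]_(m + n) :=
  if p then block_mx 0 (ursubmx x) (dlsubmx x) 0
  else block_mx (ulsubmx x) 0 0 (drsubmx x).

Definition homog p x : bool := hpart p x == x.

(* the value of the superbracket on [x] of parity [p] and [y] of parity [q] *)
Definition sbracket p q x y : 'M[k]_(m + n) :=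
  x *m y - (-1) ^+ (p && q) *: (y *m x).

Record subsuper := SubSuper {
  ss_pred :> {pred 'M[k]_(m + n)};
  ss_submod : submod_closed ss_pred;
  ss_graded : forall p x, x \in ss_pred -> hpart p x \in ss_pred;
  ss_bracket : forall p q x y, x \in ss_pred -> y \in ss_pred ->
    homog p x -> homog q y -> sbracket p q x y \in ss_pred }.

Definition even_part (l : subsuper) : {pred 'M[k]_(m + n)} :=
  [pred x | (x \in l) && homog false x].

Fact glmn_submod : submod_closed (predT : {pred 'M[k]_(m + n)}).
Proof. by []. Qed.

Definition glmn : subsuper :=
  @SubSuper predT glmn_submod (fun _ _ _ => isT) (fun _ _ _ _ _ _ _ _ => isT).

Definition upper a b (A : 'M[k]_(a, b)) : bool :=
  [forall i : 'I_a, forall j : 'I_b, (j < i)%N ==> (A i j == 0)].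

(* Within each of the four blocks, the span of the matrix units of block
   coordinates [(i, j)] with [i <= j]. *)
Definition para_pred : {pred 'M[k]_(m + n)} :=
  [pred x | [&& upper (ulsubmx x), upper (drsubmx x),
                upper (ursubmx x) & upper (dlsubmx x)]].

Lemma upperP a b (A : 'M[k]_(a, b)) :
  reflect (forall (i : 'I_a) (j : 'I_b), (j < i)%N -> A i j = 0) (upper A).
Proof.
apply: (iffP forallP) => [h i j ji | h i].
  by have /forallP/(_ j)/implyP/(_ ji)/eqP := h i.
by apply/forallP => j; apply/implyP => ji; rewrite h.
Qed.

Lemma upper0 a b : upper (0 : 'M[k]_(a, b)).
Proof. by apply/upperP => i j _; rewrite mxE. Qed.

Lemma upperL a b c (A B : 'M[k]_(a, b)) :
  upper A -> upper B -> upper (c *: A + B).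
Proof.
move=> /upperP hA /upperP hB; apply/upperP => i j ji.
by rewrite !mxE hA // hB // mulr0 addr0.
Qed.

Lemma upperD a b (A B : 'M[k]_(a, b)) : upper A -> upper B -> upper (A + B).
Proof. by move=> hA hB; rewrite -[A]scale1r upperL. Qed.

Lemma upperM a b c (A : 'M[k]_(a, b)) (B : 'M[k]_(b, c)) :
  upper A -> upper B -> upper (A *m B).
Proof.
move=> /upperP hA /upperP hB; apply/upperP => i j ji.
rewrite mxE big1 // => l _; case: (ltnP l i) => li; first by rewrite hA ?mul0r.
by rewrite hB ?mulr0 // (leq_trans ji).
Qed.

Fact para_submod : submod_closed para_pred.
Proof.
split=> [|c x y]; rewrite !inE.
  by rewrite /ulsubmx /ursubmx /dlsubmx /drsubmx !linear0 !upper0.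
move=> /and4P[? ? ? ?] /and4P[? ? ? ?].
by rewrite /ulsubmx /ursubmx /dlsubmx /drsubmx !linearP !upperL.
Qed.

Fact para_graded p x : x \in para_pred -> hpart p x \in para_pred.
Proof.
rewrite !inE => /and4P[? ? ? ?].
by case: p; rewrite /= ?block_mxKul ?block_mxKur ?block_mxKdl ?block_mxKdr
  !upper0; apply/and4P.
Qed.

Fact para_mul x y : x \in para_pred -> y \in para_pred -> x *m y \in para_pred.
Proof.
rewrite !inE => /and4P[? ? ? ?] /and4P[? ? ? ?].
rewrite -[x]submxK -[y]submxK mulmx_block.
by rewrite block_mxKul block_mxKur block_mxKdl block_mxKdr !upperD ?upperM.
Qed.

Fact para_bracket p q x y : x \in para_pred -> y \in para_pred ->
  homog p x -> homog q y -> sbracket p q x y \in para_pred.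
Proof.
move=> hx hy _ _; rewrite /sbracket -scaleNr addrC.
by case: para_submod => _; apply; apply: para_mul.
Qed.

Definition para : subsuper := SubSuper para_submod para_graded para_bracket.

Definition torus : {pred 'M[k]_(m + n)} := [pred x | is_diag_mx x].

End SubSuperalgebra.

Arguments glmn {k m n}.
Arguments para {k m n}.
Arguments torus {k m n}.

Section Supermodules.
Variables (k : fieldType) (m n : nat) (l : subsuper k m n).

(* A supermodule structure on [V]: [pr a] is the projection of
   [V = V_even (+) V_odd] onto its part of parity [a], and [act x] is the action
   of [x]; its values at [x \notin l] are irrelevant. *)
Record smod_axiom (V : lmodType k) (pr : bool -> V -> V)
    (act : 'M[k]_(m + n) -> V -> V) : Prop := SmodAxiom {
  pr_lin : forall a, linear (pr a);
  pr_sum : forall v, pr false v + pr true v = v;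
  pr_pr : forall a b v, pr a (pr b v) = if a == b then pr b v else 0;
  act_lin : forall x, x \in l -> linear (act x);
  act_linl : forall c x y v, x \in l -> y \in l ->
    act (c *: x + y) v = c *: act x v + act y v;
  act_homog : forall p a x v, x \in l -> homog p x ->
    pr a v = v -> pr (a (+) p) (act x v) = act x v;
  act_bracket : forall p q x y v, x \in l -> y \in l ->
    homog p x -> homog q y ->
    act (sbracket p q x y) v
      = act x (act y v) - (-1) ^+ (p && q) *: act y (act x v) }.

Record supermod := Supermod {
  sm_sort :> lmodType k;
  sm_pr : bool -> sm_sort -> sm_sort;
  sm_act : 'M[k]_(m + n) -> sm_sort -> sm_sort;
  sm_axiom : smod_axiom sm_pr sm_act }.

Record fdsupermod := FdSupermod {
  fd_sort :> vectType k;
  fd_pr : bool -> fd_sort -> fd_sort;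
  fd_act : 'M[k]_(m + n) -> fd_sort -> fd_sort;
  fd_axiom : smod_axiom fd_pr fd_act }.

Definition fd_supermod (M : fdsupermod) : supermod := Supermod (fd_axiom M).

(* Even linear maps commuting with the elements of [S]. *)
Definition shom (S : {pred 'M[k]_(m + n)}) (M N : supermod) (f : M -> N) :
    Prop :=
  [/\ linear f, forall a v, f (sm_pr a v) = sm_pr a (f v)
    & forall x v, x \in S -> f (sm_act x v) = sm_act x (f v)].

Arguments shom S M N f : clear implicits.

Definition siso (M N : supermod) : Prop :=
  exists f : M -> N, shom l M N f /\ bijective f.

Definition short_exact (M1 M2 M3 : supermod) (f : M1 -> M2) (g : M2 -> M3) :
    Prop :=
  [/\ shom l M1 M2 f, shom l M2 M3 g, injective f, (forall w, exists v, g v = w)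
    & forall v, g v = 0 <-> exists u, f u = v].

Definition rel_exact (M1 M2 M3 : supermod) (f : M1 -> M2) (g : M2 -> M3) :
    Prop :=
  short_exact f g /\
  exists s : M3 -> M2, shom (even_part l) M3 M2 s /\ cancel s g.

Definition rel_projective (P : supermod) : Prop :=
  forall (M1 M2 M3 : supermod) (f : M1 -> M2) (g : M2 -> M3), rel_exact f g ->
  forall h : P -> M3, shom l P M3 h ->
  exists h' : P -> M2, shom l P M2 h' /\ forall v, g (h' v) = h v.

Section CompletelyReducible.
Variables (S : {pred 'M[k]_(m + n)}) (M : fdsupermod).
Implicit Types U W : {vspace M}.

Definition subsupermod W : Prop :=
  (forall a v, v \in W -> fd_pr a v \in W) /\
  (forall x v, x \in S -> v \in W -> fd_act x v \in W).

Definition simple_sub W : Prop :=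
  [/\ subsupermod W, W != 0%VS
    & forall U, subsupermod U -> (U <= W)%VS -> U = 0%VS \/ U = W].

Definition completely_reducible : Prop :=
  exists (r : nat) (W : 'I_r -> {vspace M}),
    [/\ forall i, simple_sub (W i), directv (\sum_i W i)
      & (\sum_i W i)%VS = fullv].

End CompletelyReducible.

End Supermodules.

Arguments shom {k m n l} S M N f.

Coercion fd_supermod : fdsupermod >-> supermod.

Section BasicFacts.
Variables (k : fieldType) (m n : nat).
Implicit Types (p q : bool) (x y : 'M[k]_(m + n)).

Lemma hpart_sum x : hpart false x + hpart true x = x.
Proof. by rewrite /hpart add_block_mx !addr0 !add0r submxK. Qed.

Lemma hpartL p c x y : hpart p (c *: x + y) = c *: hpart p x + hpart p y.
Proof.
rewrite /hpart /ulsubmx /ursubmx /dlsubmx /drsubmx; case: p;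
by rewrite !linearP scale_block_mx add_block_mx !scaler0 !addr0.
Qed.

Lemma hpart_hpart p q x : hpart p (hpart q x) = if p == q then hpart q x else 0.
Proof.
by case: p; case: q; rewrite /= ?block_mxKul ?block_mxKur ?block_mxKdl
  ?block_mxKdr ?block_mx0.
Qed.

Lemma homog_hpart p x : homog p (hpart p x).
Proof. by rewrite /homog hpart_hpart eqxx. Qed.

Lemma hpartE p q x : homog p x -> hpart q x = if q == p then x else 0.
Proof. by move=> /eqP <-; rewrite hpart_hpart. Qed.

Lemma homog_sbracket p q x y :
  homog p x -> homog q y -> homog (p (+) q) (sbracket p q x y).
Proof.
rewrite /homog => /eqP <- /eqP <-; apply/eqP.
rewrite /sbracket -scaleNr addrC hpartL; congr (_ *: _ + _);
by case: p; case: q; rewrite /hpart /= !mulmx_block !mulmx0 !mul0mx ?addr0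
  ?add0r !(block_mxKul, block_mxKur, block_mxKdl, block_mxKdr).
Qed.

Lemma linfunEP (V W : vectType k) (f : V -> W) : linear f -> linfun f =1 f.
Proof.
move=> hf; pose g : {linear V -> W} := HB.pack f (GRing.isLinear.Build _ _ _ _ f hf).
exact: (lfunE g).
Qed.

Section Lin.
Variables (U V : lmodType k) (f : U -> V).
Hypothesis hf : linear f.

Lemma lin0 : f 0 = 0.
Proof.
by have := hf 1 0 0; rewrite !scale1r addr0 => h; apply: (addrI (f 0)); rewrite addr0 -h.
Qed.

Lemma linD u v : f (u + v) = f u + f v.
Proof. by rewrite -[u]scale1r hf !scale1r. Qed.

Lemma linZ c u : f (c *: u) = c *: f u.
Proof. by rewrite -[c *: u]addr0 hf lin0 addr0. Qed.

Lemma linN u : f (- u) = - f u.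
Proof. by rewrite -scaleN1r linZ scaleN1r. Qed.

Lemma lin_sum I (r : seq I) (P : pred I) F :
  f (\sum_(i <- r | P i) F i) = \sum_(i <- r | P i) f (F i).
Proof. exact: (big_morph f linD lin0). Qed.
End Lin.

Section Mod.
Variables (l : subsuper k m n) (V : lmodType k).
Variables (pr : bool -> V -> V) (act : 'M[k]_(m + n) -> V -> V).
Hypothesis H : smod_axiom l pr act.

Lemma act0l v : act 0 v = 0.
Proof.
have l0 : 0 \in l by case: (ss_submod l).
have := act_linl H 1 v l0 l0.
by rewrite !scale1r addr0 => h; apply: (addrI (act 0 v)); rewrite addr0 -h.
Qed.

Lemma act_hpart x v : x \in l ->
  act x v = act (hpart false x) v + act (hpart true x) v.
Proof.
move=> lx; rewrite -{1}(hpart_sum x) -[hpart false x]scale1r.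
by rewrite (act_linl H) ?scale1r ?ss_graded.
Qed.
End Mod.

End BasicFacts.

Section Trivial.
Variables (k : fieldType) (m n : nat) (l : subsuper k m n).

Definition triv_pr (a : bool) (v : k^o) : k^o := if a then 0 else v.
Definition triv_act (x : 'M[k]_(m + n)) (v : k^o) : k^o := 0.

Fact triv_axiom : smod_axiom l triv_pr triv_act.
Proof.
split=> //=; rewrite /triv_pr /triv_act.
- by case=> c u v //=; rewrite scaler0 addr0.
- by move=> v; rewrite addr0.
- by move=> [] [].
- by move=> x _ c u v; rewrite scaler0 addr0.
- by move=> c *; rewrite scaler0 addr0.
- by move=> ? ? *; case: ifP.
- by move=> *; rewrite scaler0 subr0.
Qed.

Definition triv : fdsupermod l := FdSupermod triv_axiom.

End Trivial.

Section DirectSum.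
Variables (k : fieldType) (m n : nat) (l : subsuper k m n).
Variables M N : fdsupermod l.

Definition dsum_pr (a : bool) (v : M * N) : M * N := (fd_pr a v.1, fd_pr a v.2).
Definition dsum_act (x : 'M[k]_(m + n)) (v : M * N) : M * N :=
  (fd_act x v.1, fd_act x v.2).

Fact dsum_axiom : smod_axiom l dsum_pr dsum_act.
Proof.
have HM := fd_axiom M; have HN := fd_axiom N.
split; rewrite /dsum_pr /dsum_act.
- by move=> a c u v /=; rewrite (pr_lin HM) (pr_lin HN).
- case=> v w /=.
  have := pr_sum HM v; have := pr_sum HN w => eN eM.
  by rewrite -[LHS]/(fd_pr false v + fd_pr true v, fd_pr false w + fd_pr true w) eN eM.
- by move=> a b v /=; rewrite (pr_pr HM) (pr_pr HN); case: (a == b).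
- by move=> x lx c u v /=; rewrite (act_lin HM lx) (act_lin HN lx).
- by move=> c x y v lx ly /=; rewrite (act_linl HM _ _ lx ly) (act_linl HN _ _ lx ly).
- move=> p a x [v w] lx px [pv pw] /=.
  by rewrite (act_homog HM lx px pv) (act_homog HN lx px pw).
- move=> p q x y v lx ly px py /=; rewrite (act_bracket HM) // (act_bracket HN) //.
Qed.

Definition dsum : fdsupermod l := FdSupermod dsum_axiom.

End DirectSum.

Section Dual.
Variables (k : fieldType) (m n : nat) (l : subsuper k m n).
Variable M : fdsupermod l.

(* [f] of parity [a] vanishes on the part of [M] of the other parity. *)
Definition dual_pr (a : bool) (f : 'Hom(M, k^o)) : 'Hom(M, k^o) :=
  (f \o linfun (fd_pr a))%VF.

(* [(x f)(v) = - (-1)^(|x||f|) f(x v)], extended to all [x] and [f] through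
   their homogeneous components *)
Definition dual_act (x : 'M[k]_(m + n)) (f : 'Hom(M, k^o)) : 'Hom(M, k^o) :=
  \sum_(p : bool) \sum_(a : bool)
    - (-1) ^+ (p && a) *: (dual_pr a f \o linfun (fd_act (hpart p x)))%VF.

Let HM := fd_axiom M.

Lemma dual_prE a f v : dual_pr a f v = f (fd_pr a v).
Proof. by rewrite comp_lfunE linfunEP //; exact: pr_lin HM a. Qed.

Lemma dual_actEs x f v : x \in l -> dual_act x f v =
  \sum_(p : bool) \sum_(a : bool)
    - (-1) ^+ (p && a) * f (fd_pr a (fd_act (hpart p x) v)).
Proof.
move=> lx; rewrite sum_lfunE; apply: eq_bigr => p _.
rewrite sum_lfunE; apply: eq_bigr => a _.
rewrite scale_lfunE comp_lfunE dual_prE linfunEP //.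
by apply: (act_lin HM); apply: ss_graded.
Qed.

Lemma dual_actE p a x f v : x \in l -> homog p x -> dual_pr a f = f ->
  dual_act x f v = - (-1) ^+ (p && a) * f (fd_act x v).
Proof.
move=> lx px fa; rewrite dual_actEs //.
have fE b w : f (fd_pr b w) = if b == a then f w else 0.
  rewrite -fa !dual_prE (pr_pr HM) eq_sym; case: eqP => [->//|_].
  by rewrite linear0.
rewrite !big_bool !fE !(hpartE _ px).
by case: p {px}; case: a {fa fE} => /=;
   rewrite !(act0l HM) ?linear0 ?mulr0 ?addr0 ?add0r.
Qed.

Lemma dual_prL a : linear (dual_pr a).
Proof.
move=> c f g; apply/lfunP => v.
by rewrite add_lfunE scale_lfunE !dual_prE add_lfunE scale_lfunE.
Qed.

Lemma dual_actL x : linear (dual_act x).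
Proof.
move=> c f g; rewrite /dual_act scaler_sumr -big_split; apply: eq_bigr => p _ /=.
rewrite scaler_sumr -big_split; apply: eq_bigr => a _ /=.
by rewrite dual_prL comp_lfunDl -comp_lfunZl scalerDr !scalerA mulrC.
Qed.

Lemma dual_pr_sum f : dual_pr false f + dual_pr true f = f.
Proof. by apply/lfunP => v; rewrite add_lfunE !dual_prE -linearD (pr_sum HM). Qed.

Fact dual_axiom : smod_axiom l dual_pr dual_act.
Proof.
have prpr a b f : dual_pr a (dual_pr b f) = if a == b then dual_pr b f else 0.
  apply/lfunP => v; rewrite !dual_prE (pr_pr HM) eq_sym.
  by case: eqP => [->|_]; rewrite ?dual_prE // linear0 zero_lfunE.
have hom p a x f : x \in l -> homog p x -> dual_pr a f = f ->
    dual_pr (a (+) p) (dual_act x f) = dual_act x f.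
  move=> lx px fa; apply/lfunP => v.
  rewrite dual_prE !(dual_actE _ lx px fa); congr (_ * _).
  rewrite -fa !dual_prE.
  rewrite -{2}[v](pr_sum HM) (linD (act_lin HM lx)) (linD (pr_lin HM a)).
  have E b : fd_pr a (fd_act x (fd_pr b v)) =
      if a == b (+) p then fd_act x (fd_pr b v) else 0.
    have <- := act_homog HM lx px (_ : fd_pr b (fd_pr b v) = fd_pr b v).
      by rewrite (pr_pr HM).
    by rewrite (pr_pr HM) eqxx.
  by rewrite !E; case: a {fa E}; case: p {px}; rewrite /= ?addr0 ?add0r.
split=> //.
- exact: dual_prL.
- exact: dual_pr_sum.
- by move=> x _; exact: dual_actL.
- move=> c x y f lx ly; rewrite /dual_act scaler_sumr -big_split.
  apply: eq_bigr => p _ /=; rewrite scaler_sumr -big_split.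
  apply: eq_bigr => a _ /=; have [_ lc] := ss_submod l.
  have E z (w : M) : z \in l ->
      linfun (fd_act (hpart p z)) w = fd_act (hpart p z) w.
    by move=> lz; apply: linfunEP; exact: (act_lin HM (ss_graded p lz)).
  have -> : linfun (fd_act (hpart p (c *: x + y))) =
      c *: linfun (fd_act (hpart p x)) + linfun (fd_act (hpart p y)) :> 'End(M).
    apply/lfunP => v; rewrite add_lfunE scale_lfunE !E ?lc // hpartL.
    by rewrite (act_linl HM) ?ss_graded.
  by rewrite comp_lfunDr -comp_lfunZr scalerDr !scalerA mulrC.
- move=> p q x y f lx ly px py.
  have lb := ss_bracket lx ly px py; have pb := homog_sbracket px py.
  suff main a g : dual_pr a g = g -> dual_act (sbracket p q x y) g =
     dual_act x (dual_act y g) - (-1) ^+ (p && q) *: dual_act y (dual_act x g).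
    have h a : dual_pr a (dual_pr a f) = dual_pr a f by rewrite prpr eqxx.
    rewrite -(dual_pr_sum f) !(linD (@dual_actL _)).
    by rewrite !(main _ _ (h _)) scalerDr opprD addrACA.
  move=> ga; apply/lfunP => v; rewrite add_lfunE opp_lfunE scale_lfunE.
  rewrite (dual_actE _ lx px (hom _ _ _ _ ly py ga)).
  rewrite (dual_actE _ ly py (hom _ _ _ _ lx px ga)).
  rewrite !(dual_actE _ lx px ga) !(dual_actE _ ly py ga).
  rewrite (dual_actE _ lb pb ga) (act_bracket HM) // linearB linearZ /=.
  rewrite /GRing.scale /=.
  case: (p); case: (q); case: (a); rewrite /= ?expr0 ?expr1; ring.
Qed.

Definition dual : fdsupermod l := FdSupermod dual_axiom.

End Dual.

Section Tensor.
Variables (k : fieldType) (m n : nat) (l : subsuper k m n).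

Definition crd (V : vectType k) (v : V) : 'rV[k]_(\dim {:V}) :=
  \row_i coord (vbasis {:V}) i v.

Definition opmx (V : vectType k) (f : V -> V) : 'M[k]_(\dim {:V}) :=
  \matrix_i crd (f (vbasis {:V})`_i).

(* [V (x) W] is the space of matrices of size [dim V * dim W]; the pure tensor
   [v (x) w] is the product of the coordinates of [v] and [w] in the bases
   [vbasis]. *)
Definition tpure (V W : vectType k) (v : V) (w : W) :
    'M[k]_(\dim {:V}, \dim {:W}) :=
  (crd v)^T *m crd w.

(* [f (x) g], see [tmapE] below *)
Definition tmap (V W : vectType k) (f : V -> V) (g : W -> W)
    (A : 'M[k]_(\dim {:V}, \dim {:W})) : 'M[k]_(\dim {:V}, \dim {:W}) :=
  (opmx f)^T *m A *m opmx g.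

Variables M N : fdsupermod l.

Definition tens_pr (a : bool) (A : 'M[k]_(\dim {:M}, \dim {:N})) :
    'M[k]_(\dim {:M}, \dim {:N}) :=
  \sum_(b : bool) tmap (@fd_pr _ _ _ _ M b) (@fd_pr _ _ _ _ N (a (+) b)) A.

(* [x (v (x) w) = x v (x) w + (-1)^(|x||v|) v (x) x w], extended to all [x] and
   [v] through their homogeneous components; see [tens_actE] below *)
Definition tens_act (x : 'M[k]_(m + n)) (A : 'M[k]_(\dim {:M}, \dim {:N})) :
    'M[k]_(\dim {:M}, \dim {:N}) :=
  tmap (@fd_act _ _ _ _ M x) id A +
  \sum_(p : bool) \sum_(a : bool) (-1) ^+ (p && a) *:
    tmap (@fd_pr _ _ _ _ M a) (@fd_act _ _ _ _ N (hpart p x)) A.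

Let HM := fd_axiom M.
Let HN := fd_axiom N.

Lemma crdL (V : vectType k) : linear (@crd V).
Proof. by move=> c u v; apply/rowP => i; rewrite !mxE linearP. Qed.

Lemma crd_opmx (V : vectType k) (f : V -> V) v :
  linear f -> crd (f v) = crd v *m opmx f.
Proof.
move=> hf; rewrite {1}(coord_vbasis (memvf v)) (lin_sum hf) (lin_sum (@crdL V)).
apply/rowP => j; rewrite mxE summxE; apply: eq_bigr => i _.
by rewrite (linZ hf) (linZ (@crdL V)) !mxE.
Qed.

Lemma tmapE (V W : vectType k) (f : V -> V) (g : W -> W) v w :
  linear f -> linear g -> tmap f g (tpure v w) = tpure (f v) (g w).
Proof.
by move=> hf hg; rewrite /tmap /tpure !crd_opmx // trmx_mul !mulmxA.
Qed.

Lemma tmapL (V W : vectType k) (f : V -> V) (g : W -> W) : linear (tmap f g).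
Proof.
by move=> c A B; rewrite /tmap mulmxDr mulmxDl -scalemxAr -scalemxAl.
Qed.

Lemma tpureLl (V W : vectType k) (w : W) : linear (fun v : V => tpure v w).
Proof.
by move=> c u v; rewrite /tpure crdL linearP /= mulmxDl scalemxAl.
Qed.

Lemma tpureLr (V W : vectType k) (v : V) : linear (fun w : W => tpure v w).
Proof.
by move=> c u w; rewrite /tpure crdL mulmxDr scalemxAr.
Qed.

Lemma crd_vbasis (V : vectType k) (i : 'I_(\dim {:V})) :
  crd (vbasis {:V})`_i = delta_mx 0 i.
Proof.
apply/rowP => j; rewrite !mxE eqxx /=.
by rewrite coord_free 1?eq_sym //; apply: basis_free (vbasisP _).
Qed.

Lemma tpure_ext (F G : 'M[k]_(\dim {:M}, \dim {:N}) ->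
    'M[k]_(\dim {:M}, \dim {:N})) :
  linear F -> linear G ->
  (forall a b (v : M) (w : N), fd_pr a v = v -> fd_pr b w = w ->
     F (tpure v w) = G (tpure v w)) -> F =1 G.
Proof.
move=> hF hG FG A.
have FG1 v w : F (tpure v w) = G (tpure v w).
  have hv a : fd_pr a (fd_pr a v) = fd_pr a v by rewrite (pr_pr HM) eqxx.
  have hw a : fd_pr a (fd_pr a w) = fd_pr a w by rewrite (pr_pr HN) eqxx.
  rewrite -(pr_sum HM v) -(pr_sum HN w).
  rewrite (linD (@tpureLl M N _)) !(linD (@tpureLr M N _)) !(linD hF) !(linD hG).
  by rewrite !(FG _ _ _ _ (hv _) (hw _)).
rewrite [A]matrix_sum_delta !(lin_sum hF, lin_sum hG); apply: eq_bigr => i _.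
rewrite !(lin_sum hF, lin_sum hG); apply: eq_bigr => j _.
rewrite (linZ hF) (linZ hG); congr (_ *: _).
have -> : delta_mx i j = tpure (vbasis {:M})`_i (vbasis {:N})`_j.
  by rewrite /tpure !crd_vbasis trmx_delta mul_delta_mx.
exact: FG1.
Qed.

Lemma tens_prL a : linear (tens_pr a).
Proof.
move=> c A B; rewrite /tens_pr scaler_sumr -big_split; apply: eq_bigr => b _.
exact: tmapL.
Qed.

Lemma tens_actL x : linear (tens_act x).
Proof.
move=> c A B; rewrite /tens_act tmapL scalerDr addrACA; congr (_ + _).
rewrite scaler_sumr -big_split; apply: eq_bigr => p _ /=.
rewrite scaler_sumr -big_split; apply: eq_bigr => a _ /=.
by rewrite tmapL scalerDr !scalerA mulrC.
Qed.

Lemma tens_prE c a b (v : M) (w : N) : fd_pr a v = v -> fd_pr b w = w ->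
  tens_pr c (tpure v w) = if c == a (+) b then tpure v w else 0.
Proof.
move=> va wb; rewrite /tens_pr big_bool.
rewrite !tmapE; try exact: pr_lin HM _; try exact: pr_lin HN _.
have prv e : fd_pr e v = if e == a then v else 0.
  by rewrite -va (pr_pr HM).
have prw e : fd_pr e w = if e == b then w else 0.
  by rewrite -wb (pr_pr HN).
rewrite !prv !prw; case: a {va prv}; case: b {wb prw}; case: c => /=;
by rewrite ?(lin0 (@tpureLl M N _)) ?(lin0 (@tpureLr M N _)) ?addr0 ?add0r.
Qed.

Lemma tens_actE p a x (v : M) (w : N) : x \in l -> homog p x ->
  fd_pr a v = v ->
  tens_act x (tpure v w) =
    tpure (fd_act x v) w + (-1) ^+ (p && a) *: tpure v (fd_act x w).
Proof.
move=> lx px va.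
have prv e : fd_pr e v = if e == a then v else 0 by rewrite -va (pr_pr HM).
rewrite /tens_act tmapE //; last exact: (act_lin HM lx).
congr (_ + _); rewrite !big_bool !tmapE; do ?[exact: pr_lin HM _];
  do ?[exact: (act_lin HN (ss_graded _ lx))].
rewrite !prv !(hpartE _ px).
case: p {px}; case: a {va prv} => /=; rewrite ?(act0l HN);
by rewrite ?(lin0 (@tpureLl M N _)) ?(lin0 (@tpureLr M N _)) ?scaler0 ?addr0
  ?add0r.
Qed.

Fact tens_axiom : smod_axiom l tens_pr tens_act.
Proof.
have hom p a x : x \in l -> homog p x -> forall A,
    tens_pr (a (+) p) (tens_act x (tens_pr a A)) = tens_act x (tens_pr a A).
  move=> lx px; apply: (@tpure_ext
    (fun A => tens_pr (a (+) p) (tens_act x (tens_pr a A)))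
    (fun A => tens_act x (tens_pr a A))).
  - by move=> c A B; rewrite tens_prL tens_actL tens_prL.
  - by move=> c A B; rewrite tens_prL tens_actL.
  move=> b c v w vb wc; rewrite (tens_prE _ vb wc).
  case: eqP => [->|_]; last by rewrite !(lin0 (@tens_actL _)) (lin0 (@tens_prL _)).
  rewrite (tens_actE _ lx px vb) (linD (@tens_prL _)) (linZ (@tens_prL _)).
  rewrite (tens_prE _ (act_homog HM lx px vb) wc).
  rewrite (tens_prE _ vb (act_homog HN lx px wc)).
  by rewrite -!addbA eqxx (addbC c) eqxx.
split.
- exact: tens_prL.
- apply: (@tpure_ext (fun A => tens_pr false A + tens_pr true A) id).
  + by move=> c A B; rewrite !tens_prL scalerDr addrACA.
  + by [].
  move=> a b v w va wb; rewrite !(tens_prE _ va wb).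
  by case: (a (+) b); rewrite ?addr0 ?add0r.
- move=> a b; apply: (@tpure_ext (fun A => tens_pr a (tens_pr b A))
    (fun A => if a == b then tens_pr b A else 0)).
  + by move=> c A B; rewrite !tens_prL.
  + by case: (a == b); [exact: tens_prL | move=> c A B; rewrite scaler0 addr0].
  move=> c d v w vc wd; rewrite !(tens_prE _ vc wd).
  case: eqP => [->|_]; last by rewrite (lin0 (@tens_prL _)); case: ifP.
  by rewrite (tens_prE _ vc wd) eq_sym; case: ifP => // /eqP ->; rewrite eqxx.
- by move=> x _; exact: tens_actL.
- move=> c x y A lx ly; have [_ lc] := ss_submod l; move: A.
  have lp q z : z \in l -> hpart q z \in l := fun lz => ss_graded q lz.
  pose G A := c *: tens_act x A + tens_act y A.
  apply: (@tpure_ext _ G); first exact: tens_actL.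
    move=> d A B; rewrite /G !tens_actL !scalerDr !scalerA (mulrC c d).
    by rewrite addrACA.
  move=> a b v w va wb; rewrite /G.
  have E z : z \in l -> tens_act z (tpure v w) = tpure (fd_act z v) w +
      \sum_(p : bool) (-1) ^+ (p && a) *: tpure v (fd_act (hpart p z) w).
    move=> lz; rewrite -{1}(hpart_sum z).
    rewrite (act_hpart HM v lz) (linD (@tpureLl M N _)) big_bool /=.
    rewrite hpart_sum /tens_act tmapE //; last exact: (act_lin HM lz).
    rewrite (act_hpart HM v lz) (linD (@tpureLl M N _)); congr (_ + _).
    rewrite !big_bool !tmapE; do ?[exact: pr_lin HM _];
      do ?[exact: (act_lin HN (ss_graded _ lz))].
    have prv e : fd_pr e v = if e == a then v else 0 by rewrite -va (pr_pr HM).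
    rewrite !prv; case: a {va prv} => /=;
    by rewrite ?(lin0 (@tpureLl M N _)) ?scaler0 ?addr0 ?add0r.
  rewrite !E ?lc // scalerDr addrACA (act_linl HM) // tpureLl; congr (_ + _).
  rewrite scaler_sumr -big_split; apply: eq_bigr => p _ /=.
  rewrite hpartL (act_linl HN) ?lp // tpureLr.
  by rewrite scalerDr !scalerA mulrC.
- by move=> p a x A lx px <-; exact: hom.
- move=> p q x y A lx ly px py; move: A.
  have lb := ss_bracket lx ly px py; have pb := homog_sbracket px py.
  pose G A := tens_act x (tens_act y A)
     - (-1) ^+ (p && q) *: tens_act y (tens_act x A).
  apply: (@tpure_ext _ G); first exact: tens_actL.
    move=> d A B; rewrite /G !tens_actL.
    move: (tens_act x (tens_act y A)) (tens_act x (tens_act y B)) => A1 B1.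
    move: (tens_act y (tens_act x A)) (tens_act y (tens_act x B)) => A2 B2.
    by apply/matrixP => i j; rewrite !mxE; ring.
  move=> a b v w va wb; rewrite /G.
  rewrite (tens_actE _ lb pb va) (tens_actE _ lx px va) (tens_actE _ ly py va).
  rewrite !(linD (@tens_actL _)) !(linZ (@tens_actL _)).
  rewrite (tens_actE _ lx px (act_homog HM ly py va)).
  rewrite (tens_actE _ ly py (act_homog HM lx px va)).
  rewrite (tens_actE _ lx px va) (tens_actE _ ly py va).
  rewrite (act_bracket HM _ lx ly px py) (act_bracket HN _ lx ly px py).
  rewrite !(linD (@tpureLl M N _)) !(linD (@tpureLr M N _)).
  rewrite !(linN (@tpureLl M N _)) !(linN (@tpureLr M N _)).
  rewrite !(linZ (@tpureLl M N _)) !(linZ (@tpureLr M N _)).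
  apply/matrixP => i j; rewrite !mxE.
  by case: (p); case: (q); case: (a); rewrite /= ?expr0 ?expr1; ring.
Qed.

Definition tens : fdsupermod l := FdSupermod tens_axiom.

End Tensor.

Section Restriction.
Variables (k : fieldType) (m n : nat) (l l' : subsuper k m n).
Hypothesis ll' : {subset l' <= l}.

Fact restrict_axiom (M : fdsupermod l) :
  smod_axiom l' (@fd_pr _ _ _ _ M) (@fd_act _ _ _ _ M).
Proof.
have H := fd_axiom M; split; first [exact: pr_lin H | exact: pr_sum H
  | exact: pr_pr H | idtac].
- by move=> x hx; exact: (act_lin H (ll' hx)).
- by move=> c x y v /ll' lx /ll' ly; exact: (act_linl H c v lx ly).
- by move=> p a x v /ll' lx; exact: (act_homog H lx).
- by move=> p q x y v /ll' lx /ll' ly; exact: (act_bracket H v lx ly).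
Qed.

Definition restrict (M : fdsupermod l) : fdsupermod l' :=
  FdSupermod (restrict_axiom M).

End Restriction.

Section MaxFree.
Variables (k : fieldType) (V : vectType k).

Lemma max_free (Q : V -> Prop) :
  exists X : seq V, [/\ free X, forall v, v \in X -> Q v
                      & forall v, Q v -> v \in <<X>>%VS].
Proof.
apply: contrapT => H.
suff /(_ (\dim {:V}).+1) [X [fX _ sX]] : forall d, exists X : seq V,
    [/\ free X, forall v, v \in X -> Q v & size X = d].
  by have := dimvS (subvf <<X>>%VS); rewrite (eqnP fX) sX ltnn.
elim=> [|d [X [fX QX sX]]]; first by exists [::]; split=> //; rewrite nil_free.
apply: contrapT => H'; apply: H; exists X; split=> // v Qv.
apply: contrapT => /negP vX; apply: H'; exists (v :: X); split.
- by rewrite free_cons vX.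
- by move=> w; rewrite inE => /orP[/eqP->//|/QX].
- by rewrite /= sX.
Qed.

Lemma lin_span (f : V -> V) (X : seq V) (U : {vspace V}) : linear f ->
  (forall v, v \in X -> f v \in U) -> forall v, v \in <<X>>%VS -> f v \in U.
Proof.
move=> hf fX v /(@coord_span _ _ _ (in_tuple X)) ->.
rewrite (lin_sum hf) memv_suml // => i _.
by rewrite (linZ hf) memvZ // fX // mem_nth.
Qed.

End MaxFree.

Section TorusSemisimple.
Variables (k : closedFieldType) (m n : nat).
Local Arguments hpart : simpl never.

Lemma eigen_sub (V : vectType k) (U : {vspace V}) (f : V -> V) : linear f ->
  U != 0%VS -> (forall v, v \in U -> f v \in U) ->
  exists c v, [/\ v \in U, v != 0 & f v = c *: v].
Proof.
move=> hf U0 fU.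
pose b := vbasis U.
pose G := \matrix_(i, j) coord b j (f b`_i) : 'M[k]_(\dim U).
have [c /rootP pc] : exists c, root (char_poly G) c.
  by apply/closed_rootP; rewrite size_char_poly eqSS dimv_eq0.
have /eigenvalueP[u uG u0] : eigenvalue G c.
  by rewrite eigenvalue_root_char; apply/rootP.
exists c, (\sum_i u 0 i *: b`_i).
have bU (i : 'I_(\dim U)) : b`_i \in U.
  by apply: vbasis_mem; rewrite mem_nth // size_tuple.
have wU : \sum_i u 0 i *: b`_i \in U by rewrite memv_suml // => i _; rewrite memvZ.
split=> //.
  apply: contra_neq u0 => w0; apply/rowP => i; rewrite mxE.
  have fb : free b := basis_free (vbasisP U).
  by rewrite -(coord_sum_free (fun i => u 0 i) i fb) w0 linear0.
rewrite (lin_sum hf) scaler_sumr.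
have E (i : 'I_(\dim U)) : f b`_i = \sum_j G i j *: b`_j.
  rewrite {1}(coord_vbasis (fU _ (bU i))); apply: eq_bigr => j _.
  by rewrite mxE.
under eq_bigr => i _ do rewrite (linZ hf) E scaler_sumr.
rewrite exchange_big /=; apply: eq_bigr => j _.
move/rowP/(_ j): uG; rewrite !mxE scalerA => <-; rewrite scaler_suml.
by apply: eq_bigr => i _; rewrite scalerA.
Qed.

Lemma hpart_falseE (x : 'M[k]_(m + n)) i j :
  hpart false x i j = x i j \/ hpart false x i j = 0.
Proof.
rewrite /hpart.
case: (split_ordP i) => a ->; case: (split_ordP j) => b ->.
- by left; rewrite block_mxEul !mxE.
- by right; rewrite block_mxEur mxE.
- by right; rewrite block_mxEdl mxE.
- by left; rewrite block_mxEdr !mxE.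
Qed.

Lemma torus_even (t : 'M[k]_(m + n)) : t \in torus -> homog false t.
Proof.
rewrite inE => /is_diag_mxP td; rewrite /homog /hpart -{3}[t]submxK; apply/eqP.
congr block_mx; apply/matrixP => i j; rewrite !mxE td //= ?eqn_leq.
  by rewrite [(m + j <= i)%N]leqNgt ltn_addr ?andbF.
by rewrite [(m + i <= j)%N]leqNgt ltn_addr.
Qed.

Lemma torus_bracket (t : 'M[k]_(m + n)) i j : t \in torus ->
  sbracket false false t (hpart false (delta_mx i j)) =
  (t i i - t j j) *: hpart false (delta_mx i j).
Proof.
rewrite inE => /diag_mxP[d ->].
rewrite /sbracket expr0 scale1r mul_mx_diag mul_diag_mx.
apply/matrixP => a b; have := hpart_falseE (delta_mx i j) a b.
move: (hpart false _) => h hE; rewrite !mxE !eqxx !mulr1n mulrBl.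
case: hE => ->; last by rewrite !mulr0 mul0r.
rewrite mxE; case: eqP => [->|_]; case: eqP => [->|_] /=;
by rewrite ?mulr1 ?mul1r ?mulr0 ?mul0r.
Qed.

Lemma act_sum (l : subsuper k m n) (M : fdsupermod l) I (r : seq I)
    (c : I -> k) (x : I -> 'M[k]_(m + n)) v : (forall i, x i \in l) ->
  \sum_(i <- r) c i *: x i \in l /\
  fd_act (\sum_(i <- r) c i *: x i) v = \sum_(i <- r) c i *: (fd_act (x i) v : M).
Proof.
move=> lx; have [l0 lc] := ss_submod l; have H := fd_axiom M.
elim: r => [|i r [IH1 IH2]]; first by rewrite !big_nil (act0l H).
by rewrite !big_cons lc // (act_linl H) // IH2.
Qed.

Variable M : fdsupermod (@glmn k m n).
Let H := fd_axiom M.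
Let inl (x : 'M[k]_(m + n)) : x \in @glmn k m n := isT.

Lemma act_torus_comm s t (v : M) : s \in torus -> t \in torus ->
  fd_act s (fd_act t v) = fd_act t (fd_act s v).
Proof.
move=> hs ht; have := act_bracket H v (inl s) (inl t) (torus_even hs) (torus_even ht).
have -> : sbracket false false s t = 0.
  move: hs ht; rewrite !inE => /diag_mxP[d ->] /diag_mxP[e ->].
  by rewrite /sbracket expr0 scale1r diag_mxC subrr.
by rewrite (act0l H) expr0 scale1r => /esym/eqP; rewrite subr_eq0 => /eqP.
Qed.

Lemma torus_gen (v : M) :
  (forall i, exists c, fd_act (delta_mx i i) v = c *: v) ->
  forall t, t \in torus -> exists c, fd_act t v = c *: v.
Proof.
move=> hv t; rewrite inE => /diag_mxP[d ->]; rewrite diag_mx_sum_delta.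
have [_ ->] := @act_sum _ M _ (index_enum _) (fun i => d 0 i)
  (fun i => delta_mx i i) v (fun i => isT).
elim: (index_enum _) => [|i r [c IH]]; first by exists 0; rewrite big_nil scale0r.
have [e he] := hv i; exists (d 0 i * e + c).
by rewrite big_cons IH he scalerA -scalerDl.
Qed.

Lemma common_weight (s : seq 'I_(m + n)) (U : {vspace M}) : U != 0%VS ->
  (forall t v, t \in torus -> v \in U -> fd_act t v \in U) ->
  exists v, [/\ v \in U, v != 0
    & forall i, i \in s -> exists c, fd_act (delta_mx i i) v = c *: v].
Proof.
elim: s U => [|i s IH] U U0 hU.
  by exists (vpick U); rewrite memv_pick vpick0.
have ti : (delta_mx i i : 'M[k]_(m + n)) \in torus.
  rewrite inE; apply/is_diag_mxP => a b ab; rewrite mxE.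
  by case: andP => // -[/eqP ai /eqP bi]; rewrite ai bi eqxx in ab.
have hl := act_lin H (inl (delta_mx i i)).
have [c [w [wU w0 wc]]] := eigen_sub hl U0 (fun v => hU _ v ti).
pose K := (lker (linfun (@fd_act _ _ _ _ M (delta_mx i i)) - c *: \1%VF))%VS.
have KE v : (v \in K) = (fd_act (delta_mx i i) v == c *: v).
  rewrite memv_ker add_lfunE opp_lfunE scale_lfunE id_lfunE linfunEP //.
  by rewrite subr_eq0.
have [||v [vU v0 vs]] := IH (U :&: K)%VS.
- apply: contraNneq w0 => UK; rewrite -memv0 -UK memv_cap wU KE.
  by apply/eqP.
- move=> t v ht; rewrite !memv_cap !KE => /andP[vU /eqP vc].
  rewrite hU //=; apply/eqP; rewrite act_torus_comm // vc.
  exact: (linZ (act_lin H (inl t))).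
exists v; move: vU; rewrite memv_cap KE => /andP[vU /eqP vc]; split=> // j.
by rewrite inE => /orP[/eqP->|/vs //]; exists c.
Qed.

Definition weightv (v : M) : Prop :=
  (exists a, fd_pr a v = v) /\
  forall t, t \in torus -> exists c, fd_act t v = c *: v.

Lemma weightv_pr a v (U : {vspace M}) : weightv v -> v \in U -> fd_pr a v \in U.
Proof.
by move=> [[b <-] _] vU; rewrite (pr_pr H); case: ifP; rewrite ?mem0v.
Qed.

Lemma weightv_act i j v :
  weightv v -> weightv (fd_act (hpart false (delta_mx i j)) v).
Proof.
move=> [[a va] wt]; split.
  exists a; have := act_homog H (inl _) (homog_hpart false (delta_mx i j)) va.
  by rewrite addbF.
move=> t ht; have [c tc] := wt t ht; exists (t i i - t j j + c).
have := act_bracket H v (inl t) (inl _) (torus_even ht)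
  (homog_hpart false (delta_mx i j)).
rewrite torus_bracket // tc expr0 scale1r (linZ (act_lin H (inl _))).
move/esym/eqP; rewrite subr_eq => /eqP ->; rewrite [RHS]scalerDl; congr (_ + _).
have := act_linl H (t i i - t j j) v (inl (hpart false (delta_mx i j))) (inl 0).
by rewrite (act0l H) !addr0.
Qed.

Lemma simple_weight (W : {vspace M}) : simple_sub (even_part glmn) W ->
  exists X : seq M, (forall v, v \in X -> weightv v) /\ W = <<X>>%VS.
Proof.
move=> [[prW actW] W0 Wmin].
have [X [fX XQ QX]] := max_free (fun v => weightv v /\ v \in W).
exists X; split; first by move=> v /XQ[].
have XW : (<<X>> <= W)%VS by apply/span_subvP => v /XQ[].
have sX : subsupermod (even_part glmn) <<X>>%VS.
  split=> [a v|x v].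
    apply: lin_span (pr_lin H a) _ v => v vX; have [wv _] := XQ v vX.
    by apply: weightv_pr wv _; apply: memv_span.
  rewrite inE /= => /eqP xe.
  apply: lin_span (act_lin H (inl x)) _ v => v vX; have [wv vW] := XQ v vX.
  have E : x = \sum_(ij : 'I_(m + n) * 'I_(m + n))
      x ij.1 ij.2 *: hpart false (delta_mx ij.1 ij.2).
    rewrite -[LHS]xe {1}[x]matrix_sum_delta pair_bigA /=.
    have hL : linear (@hpart k m n false) := @hpartL k m n false.
    by rewrite (lin_sum hL); apply: eq_bigr => ij _; rewrite (linZ hL).
  rewrite E; have [_ ->] := @act_sum _ M _ (index_enum _)
    (fun ij : 'I_(m + n) * 'I_(m + n) => x ij.1 ij.2)
    (fun ij => hpart false (delta_mx ij.1 ij.2)) v (fun i => isT).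
  rewrite memv_suml // => -[i j] _ /=; rewrite memvZ // QX //; split.
    exact: weightv_act.
  by apply: actW => //; rewrite inE /= homog_hpart.
case: (Wmin _ sX XW) => // X0; exfalso.
have [a Wa] : exists a, exists2 w, w \in W & fd_pr a w != 0.
  have w0 : vpick W != 0 by rewrite vpick0.
  apply: contrapT => N; move/eqP: w0; apply.
  rewrite -(pr_sum H (vpick W)).
  have N' a : fd_pr a (vpick W) = 0.
    by apply/eqP; apply/negPn/negP => h; apply: N; exists a; exists (vpick W);
       rewrite ?memv_pick.
  by rewrite !N' addr0.
case: Wa => w wW wa.
pose K := lker (linfun (@fd_pr _ _ _ _ M a) - \1%VF).
have KE v : (v \in K) = (fd_pr a v == v).
  rewrite memv_ker add_lfunE opp_lfunE id_lfunE linfunEP ?subr_eq0 //.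
  exact: (pr_lin H a).
have torusW t v : t \in torus -> v \in W -> fd_act t v \in W.
  by move=> ht vW; apply: actW => //; rewrite inE /= torus_even.
have [||v [vU v0 vs]] := @common_weight (enum 'I_(m + n)) (W :&: K)%VS.
- apply: contraNneq wa => UK; rewrite -memv0 -UK memv_cap prW // KE.
  by rewrite (pr_pr H) !eqxx.
- move=> t v ht; rewrite !memv_cap !KE => /andP[vW /eqP va].
  rewrite torusW //=; apply/eqP.
  by have := act_homog H (inl t) (torus_even ht) va; rewrite addbF.
move: vU; rewrite memv_cap KE => /andP[vW /eqP va].
have : v \in <<X>>%VS.
  apply: QX; split=> //; split; first by exists a.
  by apply: torus_gen => i; apply: vs; rewrite mem_enum.
by rewrite X0 memv0 (negPf v0).
Qed.

(* A sum of weight spaces is stable under [even_part glmn], so that a simple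
   [even_part glmn]-supermodule has a basis of homogeneous weight vectors. *)
Lemma torus_reducible (l' : subsuper k m n) (ll' : {subset l' <= @glmn k m n}) :
  completely_reducible (even_part glmn) M ->
  completely_reducible torus (restrict ll' M).
Proof.
move=> [r [W [sW _ sumW]]].
have [X [fX XQ QX]] := max_free weightv.
have spanX : <<X>>%VS = fullv.
  apply/eqP; rewrite eqEsubv subvf -sumW; apply/subv_sumP => i _.
  by have [Y [YQ ->]] := simple_weight (sW i); apply/span_subvP => v /YQ/QX.
exists (size X), (fun i : 'I_(size X) => <[X`_i : M]>%VS); split.
- move=> i; have [[a va] wt] := XQ _ (mem_nth 0 (ltn_ord i)).
  split=> [||U _ UX].
  + split=> [b v|t v ht] /vlineP[c ->].
      rewrite (linZ (pr_lin H b)); apply: memvZ; apply: weightv_pr.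
        by split; first by exists a.
      exact: memv_line.
    rewrite (linZ (act_lin H (inl t))); have [d ->] := wt t ht.
    by rewrite !memvZ // memv_line.
  + by rewrite -dimv_eq0 dim_vline (free_not0 fX (mem_nth 0 (ltn_ord i))).
  + case: (eqVneq U 0%VS) => [->|U0]; [by left | right].
    apply/eqP; rewrite eqEdim UX dim_vline (leq_trans (leq_b1 _)) //.
    by rewrite lt0n dimv_eq0.
- apply/directv_sum_independent => us usX us0 i _.
  have /all_sig[c cE] j : {c | us j = c *: X`_j}.
    by have /vlineP/sig_eqW[c ->] := usX j isT; exists c.
  rewrite cE; have := coord_sum_free c i (fX : free (in_tuple X)).
  rewrite -[X in coord _ _ X](eq_bigr _ (fun j _ => cE j)) us0 linear0 => <-.
  by rewrite scale0r.
- by rewrite -[RHS]spanX span_def (big_nth 0) big_mkord.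
Qed.

End TorusSemisimple.

(* The objects of [F_(l, l_0)]; [r] is the part of [l_0] over which they are
   required to be completely reducible. *)
Record fobj (k : fieldType) (m n : nat) (l : subsuper k m n)
    (r : {pred 'M[k]_(m + n)}) := Fobj {
  fobj_mod :> fdsupermod l;
  fobj_cr : completely_reducible r fobj_mod }.

Section Stmod.
Variables (k : fieldType) (m n : nat) (l : subsuper k m n).
Variable r : {pred 'M[k]_(m + n)}.
Implicit Types M N P : fobj l r.

Definition factors_proj M N (f : M -> N) : Prop :=
  exists P, rel_projective P /\
  exists (u : M -> P) (v : P -> N),
    [/\ shom l M P u, shom l P N v & forall x, f x = v (u x)].

Definition stable_eq M N (f g : M -> N) : Prop :=
  factors_proj (fun x => f x - g x).

Definition stable_iso M N : Prop :=
  exists (f : M -> N) (g : N -> M),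
    [/\ shom l M N f, shom l N M g, @stable_eq M M (g \o f) id
      & @stable_eq N N (f \o g) id].

Definition endotrivial M : Prop :=
  exists P, rel_projective P /\ siso (tens M (dual M)) (dsum (triv l) P).

(* the stable isomorphism class [M] *)
Definition stmod_class M : fobj l r -> Prop := fun N => stable_iso M N.

Definition T (c : fobj l r -> Prop) : Prop :=
  exists2 M, endotrivial M & c = stmod_class M.

End Stmod.

Section ResToParabolic.
Variables (k : closedFieldType) (m n : nat).

Definition Fg := fobj (@glmn k m n) (even_part glmn).
Definition Fp := fobj (@para k m n) torus.

Fact para_sub : {subset @para k m n <= @glmn k m n}. Proof. by []. Qed.

(* On stable classes, the restriction map is [stmod_class M |->
   stmod_class (res M)]. *)
Definition res (M : Fg) : Fp :=
  Fobj (torus_reducible para_sub (fobj_cr M)).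

End ResToParabolic.

(* Main.v *)
Require Import Defs.
From mathcomp Require Import all_boot all_order all_algebra.
From mathcomp Require Import boolp ring ssrAC zify.

(* Restriction from [g = gl(m|n)] to [p] is full: a [p]-homomorphism between finite
   dimensional [g]-modules is a vector of [Hom(M, N)] of highest weight 0 for each
   [sl_2] of [g_0], hence is [g_0]-invariant, and [g] is generated by [g_0] and [p].
   So a stable isomorphism [f : M -> N] over [p] and its stable inverse [f'] are
   [g]-homomorphisms. If [f' f - id] factors over [p] through a projective [Q], then
   the map [Q -> M] lifts over [p] to the relatively projective cover
   [P = U(g) (x)_{U(g_0)} M -> M], which splits over [g_0]; by fullness again the
   composite [M -> Q -> P] is a [g]-homomorphism, so that [f' f = id] stably over [g]
   as well. That [P] is completely reducible over [g_0] is Weyl's theorem. *)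

Set Implicit Arguments.
Unset Strict Implicit.
Unset Printing Implicit Defensive.

Import GRing.Theory.

(** * Linear algebra and matrix units *)

(** A map that factors over [p] through a projective is to factor over [g] through an object of the
    [g]-category. That object must be finite dimensional and completely reducible over [g_0], so
    most of the work goes into the induced module. It is reached without constructing [U(g)]: words
    in odd matrix units applied to an image of [M] need no more letters than there are odd units, so
    every [g]-module generated by a [g_0]-image of [M] has dimension bounded in terms of [M] alone,
    and a largest one exists. Its projection onto [M] splits over all of [g_0], hence over [p_0],
    which is what permits lifting over [p]. In the fullness argument the odd part of [p] enters
    through the units joining the first indices of the two blocks; these exist because [m] and [n]
    are positive. *)

Definition lin_closed (k : fieldType) (V : lmodType k) (Q : V -> Prop) : Prop :=
  Q 0%R /\ forall c u v, Q u -> Q v -> Q (c *: u + v)%R.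

Section LinearAlgebra.
Local Open Scope ring_scope.

Lemma lin_comp (k : fieldType) (U V W : lmodType k) (f : V -> W) (g : U -> V) :
  linear f -> linear g -> linear (f \o g).
Proof. by move=> hf hg c u v; rewrite /= hg hf. Qed.

(** Subspaces are given as predicates, which also make sense in the possibly infinite dimensional
    modules [Z] below; in finite dimension a maximal free family satisfying [Q] spans [Q]. *)
Lemma lin_vspace (k : fieldType) (V : vectType k) (Q : V -> Prop) :
  lin_closed Q -> exists U : {vspace V}, forall v, v \in U <-> Q v.
Proof.
move=> [Q0 QL]; have [X [_ XQ QX]] := max_free Q.
exists <<X>>%VS => v; split; last exact: QX.
move=> /(@coord_span _ _ _ (in_tuple X)) ->.
elim/big_ind: _ => // [x y Qx Qy|i _]; first by rewrite -[x]scale1r; apply: QL.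
by rewrite -[_ *: _]addr0; apply: QL => //; apply: XQ; rewrite mem_nth.
Qed.

Lemma memv_lin_closed (k : fieldType) (V : vectType k) (U : {vspace V}) :
  lin_closed (fun v => v \in U).
Proof. by split=> [|c u v uU vU]; rewrite ?mem0v ?memvD ?memvZ. Qed.

Variable k : closedFieldType.
Hypothesis char0 : [pchar k] =i pred0.

Lemma char0_natr_eq0 n : (n%:R == 0 :> k) = (n == 0)%N.
Proof. by have /pcharf0P := char0; apply. Qed.

Lemma char0_natrI : injective (fun n => n%:R : k).
Proof.
suff H a b : (a <= b)%N -> a%:R = b%:R :> k -> a = b.
  by move=> a b; case/orP: (leq_total a b) => h e; [|apply: esym]; apply: H.
move=> ab /esym/eqP; rewrite -subr_eq0 -natrB // char0_natr_eq0 subn_eq0 => ba.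
by apply/eqP; rewrite eqn_leq ab.
Qed.

Lemma crd_inj (V : vectType k) : injective (@crd k V).
Proof.
move=> u v /rowP uv; rewrite (coord_vbasis (memvf u)) (coord_vbasis (memvf v)).
by apply: eq_bigr => i _; have := uv i; rewrite !mxE => ->.
Qed.

(** The values [c - n] are distinct in characteristic 0, and only finitely many of them are roots of
    the characteristic polynomial. This is what stops iterated raising and lowering. *)
Lemma eigen_bounded (V : vectType k) (h : V -> V) (c : k) : linear h ->
  exists N, forall n v, (N <= n)%N -> h v = (c - n%:R) *: v -> v = 0.
Proof.
move=> hh; pose p := char_poly (opmx h).
have [rs prs] := closed_field_poly_normal p.
have [N NP] : exists N, forall n, (N <= n)%N -> c - n%:R \notin rs.
  elim: rs {prs} => [|r rs [N NP]]; first by exists 0%N.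
  case: (pselect (exists n0 : nat, r = c - n0%:R)) => [[n0 rE]|no].
    exists (maxn N n0.+1) => n; rewrite geq_max => /andP[Nn n0n].
    rewrite inE negb_or NP // andbT rE; apply: contraTneq n0n.
    by move=> /addrI/oppr_inj/char0_natrI ->; rewrite ltnn.
  exists N => n Nn; rewrite inE negb_or NP // andbT.
  by apply/eqP => E; apply: no; exists n.
exists N => n v /NP nrs hv; apply/eqP/negPn/negP => v0.
have /negP := nrs; apply.
have : root p (c - n%:R).
  rewrite -eigenvalue_root_char; apply/eigenvalueP; exists (crd v).
    by rewrite -crd_opmx // hv (linZ (@crdL _ _)).
  apply: contraNneq v0 => v0; apply/eqP/crd_inj.
  by rewrite v0 (lin0 (@crdL _ _)).
rewrite prs rootZ ?root_prod_XsubC //.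
by rewrite lead_coef_eq0 monic_neq0 // char_poly_monic.
Qed.

(* The relations are imposed modulo a subspace [V'], so that the lemma applies
   to vectors that are of highest weight only in a quotient. *)
Lemma sl2_highest (V : vectType k) (V' : {vspace V}) (e f h : V -> V) c y :
  linear e -> linear f -> linear h ->
  (forall v, e (f v) = f (e v) + h v) ->
  (forall v, h (f v) = f (h v) - 2%:R *: f v) ->
  (forall v, v \in V' -> e v \in V') -> (forall v, v \in V' -> f v \in V') ->
  y \notin V' -> e y \in V' -> h y = c *: y ->
  exists n : nat, c = n%:R /\ iter n.+1 f y \in V'.
Proof.
move=> le lf lh ef hf eV fV yV eyV hy.
have hfk r : h (iter r f y) = (c - (2 * r)%:R) *: iter r f y.
  elim: r => [|r IH]; first by rewrite muln0 subr0.
  rewrite iterS hf IH (linZ lf) -scalerBl; congr (_ *: _).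
  by rewrite mulnS natrD; ring.
have [N NP] := eigen_bounded c lh.
have ex : exists r, iter r f y \in V'.
  exists N; rewrite (NP (2 * N)%N _ _ (hfk N)) ?mem0v //.
  by rewrite mul2n -addnn leq_addr.
case: (ex_minnP ex) => -[|r] rV rmin; first by rewrite rV in yV.
(* The standard [sl_2] formula modulo [V']; at the least [r.+1] for which the iterate of [y] lies in
   [V'], the coefficient [r.+1 (c - r)] must vanish. *)
have efk s : exists2 w, w \in V' &
    e (iter s.+1 f y) = (s.+1%:R * (c - s%:R)) *: iter s f y + w.
  elim: s => [|s [w wV IH]].
    exists (f (e y)); first exact: fV.
    by rewrite /= ef hy subr0 mul1r addrC.
  exists (f w); first exact: fV.
  rewrite iterS ef IH hfk lf -iterS addrAC -scalerDl; congr (_ *: _ + _).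
  rewrite natrM -[s.+2]addn2 -[s.+1]addn1 !natrD; ring.
exists r; split=> //.
have [w wV ew] := efk r.
have : (r.+1%:R * (c - r%:R)) *: iter r f y \in V'.
  by rewrite -(addrK w (_ *: _)) -ew memvB // eV.
case: (eqVneq c r%:R) => // cr /(memvZ (r.+1%:R * (c - r%:R))^-1).
rewrite scalerA mulVf ?mulf_neq0 ?char0_natr_eq0 ?subr_eq0 // scale1r.
by move=> /rmin; rewrite ltnn.
Qed.

End LinearAlgebra.

Section MatrixUnits.
Local Open Scope ring_scope.
Variables (k : fieldType) (m n : nat).
Implicit Types (i j : 'I_(m + n)) (x : 'M[k]_(m + n)).

Definition par i j : bool := (i < m)%N != (j < m)%N.

(** The positive roots of [g_0] for the upper triangular Borel subalgebra. *)
Definition pos i j : bool := (i < j)%N && ~~ par i j.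

Lemma hpartEij p x i j : hpart p x i j = if par i j == p then x i j else 0.
Proof.
rewrite -{2}[x]submxK /hpart /par.
case: (split_ordP i) => a ->; case: (split_ordP j) => b ->;
  rewrite /= ?ltn_ord ?[(m + _ < m)%N]ltnNge ?leq_addr /=; case: p;
  by rewrite !(block_mxEul, block_mxEur, block_mxEdl, block_mxEdr) ?mxE.
Qed.

Lemma homog_delta i j : homog (par i j) (delta_mx i j : 'M[k]_(m + n)).
Proof.
apply/eqP/matrixP => a b; rewrite hpartEij mxE.
by case: eqP => // ne; case: andP => // -[/eqP ai /eqP bj]; case: ne; rewrite ai bj.
Qed.

Lemma par_pos i j : pos i j -> par i j = false.
Proof. by case/andP => _ /negbTE. Qed.

Lemma parC i j : par i j = par j i.
Proof. by rewrite /par eq_sym. Qed.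

Lemma par_trans i j l : par i l = par i j (+) par j l.
Proof. by rewrite /par; case: (i < m)%N; case: (j < m)%N; case: (l < m)%N. Qed.

Lemma parii i : par i i = false.
Proof. by rewrite /par eqxx. Qed.

Lemma posii i : pos i i = false.
Proof. by rewrite /pos ltnn. Qed.

Lemma homogB p x y : homog p x -> homog p y -> homog p (x - y).
Proof.
move=> /eqP hx /eqP hy; apply/eqP.
by rewrite -scaleN1r addrC hpartL hx hy.
Qed.

Lemma sbracket_delta p q i j a b :
  sbracket p q (delta_mx i j : 'M[k]_(m + n)) (delta_mx a b) =
  (j == a)%:R *: delta_mx i b - (-1) ^+ (p && q) *: ((b == i)%:R *: delta_mx a j).
Proof.
by rewrite /sbracket !mul_delta_mx_cond !scaler_nat.
Qed.

Variable Z : supermod (@glmn k m n).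
Let H := sm_axiom Z.
Let inl x : x \in @glmn k m n := isT.
Implicit Types v : Z.

Lemma act_linear x : linear (@sm_act _ _ _ _ Z x).
Proof. exact: (act_lin H (inl x)). Qed.

Lemma actDl x y v : sm_act (x + y) v = sm_act x v + sm_act y v.
Proof. by have := act_linl H 1 v (inl x) (inl y); rewrite !scale1r. Qed.

Lemma actZl c x v : sm_act (c *: x) v = c *: sm_act x v.
Proof.
by have := act_linl H c v (inl x) (inl 0); rewrite addr0 (act0l H) addr0.
Qed.

Lemma actBl x y v : sm_act (x - y) v = sm_act x v - sm_act y v.
Proof. by rewrite -[- y]scaleN1r actDl actZl scaleN1r. Qed.

Lemma act_swap p q x y v : homog p x -> homog q y ->
  sm_act x (sm_act y v) =
  sm_act (sbracket p q x y) v + (-1) ^+ (p && q) *: sm_act y (sm_act x v).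
Proof. by move=> px qy; rewrite (act_bracket H) ?subrK. Qed.

Lemma act_even_delta i j a b v : par i j = false ->
  sm_act (delta_mx i j) (sm_act (delta_mx a b) v) =
  sm_act (delta_mx a b) (sm_act (delta_mx i j) v)
    + ((j == a)%:R *: sm_act (delta_mx i b) v
      - (b == i)%:R *: sm_act (delta_mx a j) v).
Proof.
move=> ij; rewrite (act_swap _ (homog_delta i j) (homog_delta a b)) ij.
by rewrite sbracket_delta expr0 !scale1r actBl !actZl addrC.
Qed.

Lemma act_delta_sum x v :
  sm_act x v = \sum_i \sum_j x i j *: sm_act (delta_mx i j) v.
Proof.
rewrite {1}[x]matrix_sum_delta !pair_bigA /=.
rewrite (big_morph (fun y => sm_act y v) (fun y z => actDl y z v) (act0l H v)).
by apply: eq_bigr => -[i j] _; rewrite actZl.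
Qed.

Lemma homog_mem p x (Q : Z -> Prop) v : lin_closed Q -> homog p x ->
  (forall i j, par i j = p -> Q (sm_act (delta_mx i j) v)) -> Q (sm_act x v).
Proof.
move=> [Q0 QL] /eqP <- Qd; rewrite act_delta_sum pair_bigA /=.
elim/big_rec: _ => // -[i j] w _ Qw /=; rewrite hpartEij; case: eqP => [pij|_].
  by apply: QL => //; apply: Qd.
by rewrite scale0r add0r.
Qed.

Lemma sm_pr_act p a x v : homog p x ->
  sm_pr a (sm_act x v) = sm_act x (sm_pr (a (+) p) v).
Proof.
move=> px; rewrite -{1}(pr_sum H v) (linD (act_linear x)) (linD (pr_lin H a)).
have E b : sm_pr a (sm_act x (sm_pr b v)) =
    if a == b (+) p then sm_act x (sm_pr b v) else 0.
  have bb : sm_pr b (sm_pr b v) = sm_pr b v by rewrite (pr_pr H) eqxx.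
  by rewrite -(act_homog H (inl x) px bb) (pr_pr H).
by rewrite !E; case: (a); case: (p); rewrite /= ?addr0 ?add0r.
Qed.

End MatrixUnits.

Section FdMatrixUnits.
Local Open Scope ring_scope.
Variables (k : fieldType) (m n : nat) (M : fdsupermod (@glmn k m n)).
Implicit Types (i j : 'I_(m + n)) (x y : 'M[k]_(m + n)) (v : M).

Lemma fd_act_linear x : linear (@fd_act _ _ _ _ M x).
Proof. exact: (@act_linear _ _ _ M). Qed.

Lemma fd_actZl c x v : fd_act (c *: x) v = c *: (fd_act x v : M).
Proof. exact: (@actZl _ _ _ M). Qed.

Lemma fd_actBl x y v : fd_act (x - y) v = (fd_act x v : M) - fd_act y v.
Proof. exact: (@actBl _ _ _ M). Qed.

Lemma fd_act_swap p q x y v : homog p x -> homog q y ->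
  fd_act x (fd_act y v) =
  (fd_act (sbracket p q x y) v : M) + (-1) ^+ (p && q) *: fd_act y (fd_act x v).
Proof. exact: (@act_swap _ _ _ M). Qed.

Lemma fd_act_even_delta i j a b v : par i j = false ->
  fd_act (delta_mx i j) (fd_act (delta_mx a b) v) =
  (fd_act (delta_mx a b) (fd_act (delta_mx i j) v) : M)
    + ((j == a)%:R *: fd_act (delta_mx i b) v
      - (b == i)%:R *: fd_act (delta_mx a j) v).
Proof. exact: (@act_even_delta _ _ _ M). Qed.

Lemma fd_homog_mem p x (Q : M -> Prop) v : lin_closed Q -> homog p x ->
  (forall i j, par i j = p -> Q (fd_act (delta_mx i j) v)) -> Q (fd_act x v).
Proof. exact: (@homog_mem _ _ _ M). Qed.

Lemma fd_act_delta_sum x v :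
  fd_act x v = \sum_i \sum_j x i j *: (fd_act (delta_mx i j) v : M).
Proof. exact: (@act_delta_sum _ _ _ M). Qed.

Lemma fd_pr_act p a x v : homog p x ->
  fd_pr a (fd_act x v) = fd_act x (fd_pr (a (+) p) v : M).
Proof. exact: (@sm_pr_act _ _ _ M). Qed.

End FdMatrixUnits.

(** * Fullness of the restriction *)

Section FullyFaithful.
Local Open Scope ring_scope.
Variables (k : closedFieldType) (m n : nat).
Hypothesis char0 : [pchar k] =i pred0.
Variables M N : fdsupermod (@glmn k m n).
Implicit Types (x y : 'M[k]_(m + n)) (g : 'Hom(M, N)).

(** The action of [x] on [Hom(M, N)] without the sign rule, hence an action of [g_0] only;
    [ad x g = 0] says that [g] commutes with [x]. *)
Definition ad x g : 'Hom(M, N) :=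
  ((linfun (@fd_act _ _ _ _ N x) \o g) - (g \o linfun (@fd_act _ _ _ _ M x)))%VF.

Lemma adE x g v : ad x g v = fd_act x (g v) - g (fd_act x v).
Proof.
rewrite /ad add_lfunE opp_lfunE !comp_lfunE !linfunEP //.
  exact: (@fd_act_linear _ _ _ M).
exact: (@fd_act_linear _ _ _ N).
Qed.

Lemma ad_linear x : linear (ad x).
Proof.
move=> c g h; apply/lfunP => v.
rewrite adE [RHS]add_lfunE scale_lfunE !adE !add_lfunE !scale_lfunE.
rewrite (@fd_act_linear _ _ _ N) scalerBr opprD.
by rewrite addrACA.
Qed.

Lemma ad_swap x y g : homog false x -> homog false y ->
  ad x (ad y g) = ad y (ad x g) + ad (sbracket false false x y) g.
Proof.
move=> hx hy; apply/lfunP => v; rewrite [RHS]add_lfunE !adE.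
have swN := @fd_act_swap _ _ _ N false false x y _ hx hy.
have swM := @fd_act_swap _ _ _ M false false x y _ hx hy.
rewrite !(linD (@fd_act_linear _ _ _ N _)) !(linN (@fd_act_linear _ _ _ N _)).
rewrite (swN (g v)) (swM v) /= !expr0 !scale1r [g (_ + _)]linearD.
rewrite !opprD !opprK !addrA.
by rewrite [RHS](ACl (6*1*3*2*5*4*7)) /= addrK.
Qed.

Lemma adZl c x g : ad (c *: x) g = c *: ad x g.
Proof.
apply/lfunP => v; rewrite [RHS]scale_lfunE !adE scalerBr.
by rewrite !(@fd_actZl _ _ _ N) !(@fd_actZl _ _ _ M) linearZ.
Qed.

Lemma hom_lowering (f : M -> N) i j : linear f -> pos i j ->
  (forall a b, pos a b || (a == b) -> forall v,
     f (fd_act (delta_mx a b) v) = fd_act (delta_mx a b) (f v)) ->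
  forall v, f (fd_act (delta_mx j i) v) = fd_act (delta_mx j i) (f v).
Proof.
move=> lf pij fC; pose y : 'Hom(M, N) := linfun f.
have yE v : y v = f v by rewrite /y linfunEP.
have yC a b : pos a b || (a == b) -> ad (delta_mx a b) y = 0.
  move=> ab; apply/lfunP => v; rewrite adE !yE fC //.
  by rewrite subrr zero_lfunE.
have ij0 := par_pos pij; have ji0 : par j i = false by rewrite parC.
have ij : (i == j) = false by case/andP: pij => /ltn_eqF.
have hd a b : par a b = false -> homog false (delta_mx a b : 'M[k]_(m + n)).
  by move=> <-; exact: homog_delta.
pose h : 'M[k]_(m + n) := delta_mx i i - delta_mx j j.
have hh : homog false h by rewrite homogB ?hd ?parii.
have hE g : ad h g = ad (delta_mx i i) g - ad (delta_mx j j) g.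
  apply/lfunP => v; rewrite [RHS]add_lfunE opp_lfunE !adE.
  rewrite !(@fd_actBl _ _ _ N) !(@fd_actBl _ _ _ M) linearB /=.
  by rewrite !opprD !opprK addrACA.
suff /lfunP y0 : ad (delta_mx j i) y = 0.
  move=> v; have := y0 v; rewrite adE !yE zero_lfunE => /eqP.
  by rewrite subr_eq0 => /eqP.
case: (eqVneq y 0) => [->|yn0]; first exact: (lin0 (@ad_linear _)).
have [|||||||r [r0]] := @sl2_highest _ char0 _ 0%VS (ad (delta_mx i j))
  (ad (delta_mx j i)) (ad h) 0 y (@ad_linear _) (@ad_linear _) (@ad_linear _).
- move=> g; rewrite ad_swap ?hd //; congr (_ + ad _ _).
  by rewrite sbracket_delta !eqxx expr0 !scale1r.
- move=> g; rewrite ad_swap ?hd //; congr (_ + _).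
  rewrite -scaleNr -adZl; congr (ad _ _).
  rewrite /sbracket expr0 scale1r mulmxBl mulmxBr !mul_delta_mx_cond.
  rewrite !eqxx ij !mulr0n !mulr1n subr0 sub0r -opprD.
  by rewrite scaleNr scaler_nat mulr2n.
- by move=> v; rewrite memv0 => /eqP ->; rewrite (lin0 (@ad_linear _)) mem0v.
- by move=> v; rewrite memv0 => /eqP ->; rewrite (lin0 (@ad_linear _)) mem0v.
- by rewrite memv0.
- by rewrite yC ?pij // mem0v.
- by rewrite hE !yC ?eqxx ?orbT // subrr scale0r.
(* The highest weight is 0, so one application of the lowering operator already gives zero. *)
have -> : r = 0%N by apply: (char0_natrI char0).
by rewrite /= memv0 => /eqP.
Qed.

Lemma delta_para (i j : 'I_(m + n)) : (i <= j)%N -> ~~ par i j ->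
  (delta_mx i j : 'M[k]_(m + n)) \in para.
Proof.
move=> ij pij; rewrite /= !inE.
by apply/and4P; split; apply/upperP => a b ba; rewrite !mxE;
  case: andP => // -[/eqP ai /eqP bj]; move: ij pij; rewrite -ai -bj /par /=;
  rewrite ?leq_add2l ?ltn_ord ?[(m + _ < m)%N]ltnNge ?leq_addr // leqNgt ba.
Qed.

(* [e_ij] of odd parity is obtained from the [e_ab] of [para] with [a] and [b]
   the first indices of the two blocks by two brackets with even matrix units. *)
Theorem para_hom_full (f : M -> N) : (0 < m)%N -> (0 < n)%N ->
  @shom _ _ _ para para (restrict (@para_sub k m n) M)
    (restrict (@para_sub k m n) N) f ->
  @shom _ _ _ glmn glmn M N f.
Proof.
move=> m0 n0 [lf prf fp]; split=> // x v _.
pose C x := forall v, f (fd_act x v) = fd_act x (f v).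
have Cpara y : y \in para -> C y by move=> yp w; exact: (fp y w yp).
have Cup (i j : 'I_(m + n)) : pos i j || (i == j) -> C (delta_mx i j).
  case/orP=> [/andP[ij pij]|/eqP ->]; apply: Cpara; apply: delta_para => //.
    exact: ltnW.
  by rewrite parii.
have Cev (i j : 'I_(m + n)) : par i j = false -> C (delta_mx i j).
  move=> pij; case: (ltngtP i j) => [ij|ji|/val_inj ->].
  - by apply: Cup; rewrite /pos ij pij.
  - by apply: (hom_lowering lf _ Cup); rewrite /pos ji parC pij.
  - by apply: Cup; rewrite eqxx orbT.
have Cl (i j b : 'I_(m + n)) : par i j = false -> b != i ->
    C (delta_mx i j) -> C (delta_mx j b) -> C (delta_mx i b).
  move=> pij /negPf bi C1 C2 w.
  have := fd_act_even_delta j b w pij; have := fd_act_even_delta j b (f w) pij.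
  rewrite bi eqxx !scale0r !subr0 !scale1r => EN EM.
  apply: (addrI (fd_act (delta_mx j b) (fd_act (delta_mx i j) (f w)))).
  by rewrite -EN -(C1 w) -C2 -(linD lf) -EM C1 C2.
have Cr (i j b : 'I_(m + n)) : par j b = false -> b != i ->
    C (delta_mx i j) -> C (delta_mx j b) -> C (delta_mx i b).
  move=> pjb /negPf bi C1 C2 w.
  have := fd_act_even_delta i j w pjb; have := fd_act_even_delta i j (f w) pjb.
  rewrite bi eqxx !scale0r !sub0r !scale1r => EN EM.
  apply: oppr_inj; rewrite -(linN lf).
  apply: (addrI (fd_act (delta_mx i j) (fd_act (delta_mx j b) (f w)))).
  by rewrite -EN -(C2 w) -C1 -(linD lf) -EM C2 C1.
have Codd (i j : 'I_(m + n)) : par i j -> C (delta_mx i j).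
  move=> pij.
  pose first_ (i : 'I_(m + n)) : 'I_(m + n) :=
    if (i < m)%N then lshift n (Ordinal m0) else rshift m (Ordinal n0).
  have par1 a : par a (first_ a) = false.
    rewrite /par /first_; case: ltnP => //= am; first by rewrite m0.
    by rewrite addn0 ltnn.
  have odd_ne a b : par a b -> b != a.
    by apply: contraTneq => ->; rewrite parii.
  have p1 : par (first_ i) (first_ j).
    by rewrite (par_trans _ i) parC par1 (par_trans _ j) pij par1.
  (* Within its block this unit sits in position [(0, 0)], hence it belongs to [para]. *)
  have C1 : C (delta_mx (first_ i) (first_ j)).
    apply: Cpara; move: p1; rewrite /par /first_; case: ifP => _; case: ifP => _;
    rewrite ?eqxx // => _; rewrite /= !inE; apply/and4P; split; apply/upperP;
    move=> a b ba; rewrite !mxE; case: andP => // -[/eqP ai /eqP bj]; exfalso;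
    move/(congr1 val): ai; move/(congr1 val): bj => /=;
    have := ltn_ord a; have := ltn_ord b; lia.
  have C2 : C (delta_mx i (first_ j)).
    apply: (Cl _ _ _ _ _ _ C1); rewrite ?par1 //; first last.
      by apply: Cev; rewrite par1.
    by apply: odd_ne; rewrite (par_trans _ j) pij par1.
  apply: (Cr _ _ _ _ _ C2); rewrite ?odd_ne //; first by rewrite parC par1.
  by apply: Cev; rewrite parC par1.
have Cd i j : C (delta_mx i j).
  by case pij: (par i j); [exact: Codd | exact: Cev].
change (f (fd_act x v) = fd_act x (f v)).
rewrite !fd_act_delta_sum (lin_sum lf); apply: eq_bigr => i _.
rewrite (lin_sum lf); apply: eq_bigr => j _.
by rewrite (linZ lf) Cd.
Qed.

End FullyFaithful.

(** * Modules generated by an image *)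

Section Supermodules.
Local Open Scope ring_scope.
Variables (k : fieldType) (m n : nat) (l : subsuper k m n).

Lemma transport (Z : supermod l) (W : vectType k) (iota : W -> Z) :
  linear iota -> injective iota ->
  (forall a w, exists w', iota w' = sm_pr a (iota w)) ->
  (forall x w, x \in l -> exists w', iota w' = sm_act x (iota w)) ->
  exists pr act (ax : @smod_axiom k m n l W pr act),
    shom l (FdSupermod ax) Z iota.
Proof.
move=> li ii prI actI; have H := sm_axiom Z.
pose pr a := projT1 (choice (prI a)).
have prE a w : iota (pr a w) = sm_pr a (iota w) := projT2 (choice (prI a)) w.
(* Outside [l] the action is arbitrary, with 0 as default. *)
have actI' x w : exists w', x \in l -> iota w' = sm_act x (iota w).
  by case: (boolP (x \in l)) => [/(actI x w)[w' E]|_]; [exists w' | exists 0].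
pose act x := projT1 (choice (actI' x)).
have actE x w : x \in l -> iota (act x w) = sm_act x (iota w).
  exact: (projT2 (choice (actI' x)) w).
suff ax : @smod_axiom k m n l W pr act by exists pr, act, ax; split.
have [_ lc] := ss_submod l.
split.
- by move=> a c u v; apply: ii; rewrite li !prE li (pr_lin H).
- by move=> v; apply: ii; rewrite (linD li) !prE (pr_sum H).
- move=> a b v; apply: ii; rewrite !prE (pr_pr H).
  by case: ifP; rewrite ?prE ?(lin0 li).
- by move=> x lx c u v; apply: ii; rewrite li !actE // li (act_lin H lx).
- move=> c x y v lx ly; apply: ii.
  by rewrite li !actE ?lc // (act_linl H c _ lx ly).
- move=> p a x v lx px /(congr1 iota); rewrite prE => av.
  by apply: ii; rewrite prE actE // (act_homog H lx px av).
- move=> p q x y v lx ly px qy; apply: ii.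
  rewrite (linD li) (linN li) (linZ li) !actE ?(ss_bracket lx ly px qy) //.
  by rewrite (act_bracket H).
Qed.

Variables Z1 Z2 : supermod l.

(** The counterpart of [dsum] in any dimension: the universal property of the induced module is
    tested against every supermodule [Z]. *)
Definition sdsum_pr (a : bool) (v : Z1 * Z2) : Z1 * Z2 :=
  (sm_pr a v.1, sm_pr a v.2).
Definition sdsum_act (x : 'M[k]_(m + n)) (v : Z1 * Z2) : Z1 * Z2 :=
  (sm_act x v.1, sm_act x v.2).

Fact sdsum_axiom : smod_axiom l sdsum_pr sdsum_act.
Proof.
have H1 := sm_axiom Z1; have H2 := sm_axiom Z2.
split; rewrite /sdsum_pr /sdsum_act.
- by move=> a c u v /=; rewrite (pr_lin H1) (pr_lin H2).
- by case=> v w /=; congr pair; rewrite ?(pr_sum H1) ?(pr_sum H2).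
- by move=> a b v /=; rewrite (pr_pr H1) (pr_pr H2); case: (a == b).
- by move=> x lx c u v /=; rewrite (act_lin H1 lx) (act_lin H2 lx).
- by move=> c x y v lx ly /=; rewrite (act_linl H1 _ _ lx ly) (act_linl H2 _ _ lx ly).
- move=> p a x [v w] lx px [pv pw] /=.
  by rewrite (act_homog H1 lx px pv) (act_homog H2 lx px pw).
- by move=> p q x y v lx ly px py /=; rewrite (act_bracket H1) // (act_bracket H2).
Qed.

Definition sdsum : supermod l := Supermod sdsum_axiom.

End Supermodules.

(** * Words in odd matrix units, filtered by length *)

Section Words.
Local Open Scope ring_scope.
Variables (k : closedFieldType) (m n : nat).
Hypothesis char0 : [pchar k] =i pred0.
Variables (M : fdsupermod (@glmn k m n)) (Z : supermod (@glmn k m n)).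
Variable phi : M -> Z.
Hypothesis phiP : shom (even_part glmn) M Z phi.
Implicit Types (v : Z) (u : M) (w : seq ('I_(m + n) * 'I_(m + n))).
Implicit Types (x : 'M[k]_(m + n)) (Q : Z -> Prop).

Definition word w v : Z :=
  foldr (fun ij => sm_act (delta_mx ij.1 ij.2)) v w.

Definition oddw w : bool := all (fun ij => par ij.1 ij.2) w.

(* The span of the words of length at most [r] in odd matrix units, applied to
   the image of [phi]. *)
Definition filt r v : Prop := forall Q, lin_closed Q ->
  (forall w u, (size w <= r)%N -> oddw w -> Q (word w (phi u))) -> Q v.

Lemma filt_lin r : lin_closed (filt r).
Proof.
split=> [|c u v hu hv] Q lQ QW; have [Q0 QL] := lQ => //.
by apply: QL; [apply: hu | apply: hv].
Qed.

Lemma filtZ r c v : filt r v -> filt r (c *: v).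
Proof.
by move=> h; rewrite -[_ *: _]addr0; have [h0 hL] := filt_lin r; apply: hL.
Qed.

Lemma filtD r v v' : filt r v -> filt r v' -> filt r (v + v').
Proof.
by move=> h h'; rewrite -[v]scale1r; have [h0 hL] := filt_lin r; apply: hL.
Qed.

Lemma filt_mono r s v : (r <= s)%N -> filt r v -> filt s v.
Proof.
move=> rs h Q lQ QW; apply: h => // w u wr; apply: QW.
exact: leq_trans wr rs.
Qed.

Lemma filt_word r w u : (size w <= r)%N -> oddw w -> filt r (word w (phi u)).
Proof. by move=> wr ow Q _; apply. Qed.

Lemma filt_map r (f : Z -> Z) Q : linear f -> lin_closed Q ->
  (forall w u, (size w <= r)%N -> oddw w -> Q (f (word w (phi u)))) ->
  forall v, filt r v -> Q (f v).
Proof.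
move=> lf [Q0 QL] Qf v hv; apply: (hv (fun z => Q (f z))) => //; split=> [|c u u' hu hu'].
  by rewrite (lin0 lf).
by rewrite lf; apply: QL.
Qed.

Lemma filt_odd_delta r i j v : par i j -> filt r v ->
  filt r.+1 (sm_act (delta_mx i j) v).
Proof.
move=> pij; apply: filt_map; [exact: act_linear | exact: filt_lin |].
by move=> w u wr ow; apply: (@filt_word _ ((i, j) :: w)) => //=; rewrite pij.
Qed.

Lemma filt_odd r x v : homog true x -> filt r v -> filt r.+1 (sm_act x v).
Proof.
move=> px hv; apply: (homog_mem (filt_lin _) px) => i j pij.
exact: filt_odd_delta.
Qed.

(** Moving an even element past an odd letter leaves an odd bracket in place of that letter, so the
    length does not grow; at the end of the word the element is absorbed by [phi]. *)
Lemma filt_even r x v : homog false x -> filt r v -> filt r (sm_act x v).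
Proof.
move=> px; apply: filt_map; [exact: act_linear | exact: filt_lin |].
move=> w u wr ow; apply: filt_mono wr _.
elim: w ow x px => [_ x px|[i j] w IH /= /andP[pij ow] x px].
  have [_ _ phiA] := phiP.
  by rewrite /= -phiA ?inE //; apply: (@filt_word _ [::]).
have hij : homog true (delta_mx i j : 'M[k]_(m + n)).
  by rewrite -pij; apply: homog_delta.
rewrite (act_swap _ px hij) /= expr0 scale1r addrC; apply: filtD.
  by apply: filt_odd_delta => //; apply: IH.
apply: filt_odd (filt_word _ _ _) => //.
exact: (homog_sbracket px hij).
Qed.

(* Odd root vectors anticommute up to [g_0] and have square in [g_0], so that
   a repeated letter shortens a word. *)
Lemma filt_repeat i j w w' u : par i j -> oddw w -> oddw w' ->
  filt (size w + size w').+1 (word ((i, j) :: w ++ (i, j) :: w') (phi u)).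
Proof.
move=> pij; elim: w => [_ ow'|[a b] w IH /= /andP[pab ow] ow'].
  have hij : homog true (delta_mx i j : 'M[k]_(m + n)).
    by rewrite -pij; apply: homog_delta.
  set x := delta_mx i j in hij *; rewrite /= add0n -/x.
  set v := word w' (phi u).
  (* For odd [x] this reads [2 x x v = [x, x] v] with [[x, x]] even, and 2 is invertible. *)
  have := @act_swap _ _ _ Z true true x x v hij hij.
  rewrite /= expr1 scaleN1r => /eqP; rewrite -subr_eq opprK -mulr2n -scaler_nat.
  move=> /eqP/(congr1 (fun z => 2%:R^-1 *: z)).
  rewrite scalerA mulVf ?char0_natr_eq0 // scale1r => ->.
  apply: filtZ; apply: (filt_mono (leqnSn _)).
  apply: filt_even; last exact: filt_word.
  exact: (homog_sbracket hij hij).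
have hij : homog true (delta_mx i j : 'M[k]_(m + n)).
  by rewrite -pij; apply: homog_delta.
have hab : homog true (delta_mx a b : 'M[k]_(m + n)).
  by rewrite -pab; apply: homog_delta.
rewrite addSn (act_swap _ hij hab). apply: filtD; last first.
  by apply: filtZ; apply: filt_odd_delta => //; apply: IH.
apply: filt_even; first exact: (homog_sbracket hij hab).
apply: filt_word; first by rewrite size_cat /= addnS leqW.
by rewrite /oddw all_cat -/(oddw w) ow /= pij.
Qed.

Definition odd_units : seq ('I_(m + n) * 'I_(m + n)) :=
  [seq ij <- enum predT | par ij.1 ij.2].

(** A word with more letters than there are odd units repeats one, hence is a combination of shorter
    words. The filtration therefore stops growing here, and its last term is a submodule. *)
Lemma filt_stationary i j v : filt (size odd_units) v ->
  filt (size odd_units) (sm_act (delta_mx i j) v).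
Proof.
case pij: (par i j); last first.
  by apply: filt_even; rewrite -pij; apply: homog_delta.
apply: filt_map; [exact: act_linear | exact: filt_lin |].
move=> w u; rewrite leq_eqVlt => /orP[/eqP wN|wN] oww; last first.
  by apply: (@filt_word _ ((i, j) :: w)) => //=; rewrite pij.
have oijw : oddw ((i, j) :: w) by rewrite /= pij.
have /negP : ~ uniq ((i, j) :: w).
  move=> uw.
  suff /(uniq_leq_size uw) : {subset (i, j) :: w <= odd_units}.
    by rewrite /= wN ltnn.
  by move=> ab /(allP oijw) pab; rewrite mem_filter pab mem_enum.
change (sm_act (delta_mx i j) (word w (phi u))) with (word ((i, j) :: w) (phi u)).
have -> : size odd_units = (size ((i, j) :: w)).-1 by rewrite /= wN.
elim: ((i, j) :: w) oijw => // -[a b] w' IH /andP[pab ow].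
have {ow}ow' : oddw w' by [].
rewrite /= negb_and negbK => /orP[abw|h0].
  case/splitPr: abw ow' => p1 p2; rewrite /oddw all_cat => /andP[o1 /andP[_ o2]].
  rewrite size_cat /= addnS; exact: (filt_repeat u pab o1 o2).
have w'0 : (0 < size w')%N.
  by case: w' {IH ow'} h0.
have h := IH ow' h0.
by rewrite -(prednK w'0); apply: filt_odd_delta.
Qed.

Lemma filt_pr r a v : filt r v -> filt r (sm_pr a v).
Proof.
apply: filt_map; [exact: pr_lin (sm_axiom Z) a | exact: filt_lin |].
move=> w u wr ow; suff [b ->] : exists b,
    sm_pr a (word w (phi u)) = word w (phi (fd_pr b u)) by exact: filt_word.
have [_ phip _] := phiP.
elim: w a {wr ow} => [|[i j] w IH] a /=; first by exists a; rewrite -phip.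
rewrite (sm_pr_act _ _ (homog_delta _ i j)).
by have [b ->] := IH (a (+) par i j); exists b.
Qed.

(** Repetitions in this list are harmless: it has to be finite and complete, and only its size
    enters the dimension bound. *)
Fixpoint words r : seq (seq ('I_(m + n) * 'I_(m + n))) :=
  if r is r'.+1 then words r' ++ [seq ij :: w | ij <- odd_units, w <- words r']
  else [:: [::]].

Lemma mem_words r w : (size w <= r)%N -> oddw w -> w \in words r.
Proof.
elim: r w => [|r IH] [|ij w] //= wr.
  by move=> _; rewrite mem_cat; apply/orP; left; apply: IH.
move=> /andP[pij ow]; rewrite mem_cat; apply/orP; right.
by apply: allpairs_f; [rewrite mem_filter mem_enum andbT | apply: IH].
Qed.

Lemma words_odd r w : w \in words r -> (size w <= r)%N /\ oddw w.
Proof.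
elim: r w => [|r IH] w /=; first by rewrite inE => /eqP ->.
rewrite mem_cat => /orP[/IH[wr ow]|]; first by rewrite leqW.
case/allpairsP => -[ij w'] /= [ijo /IH[wr ow] ->] /=; split=> //.
by rewrite ow andbT; move: ijo; rewrite mem_filter => /andP[].
Qed.

Let N := size odd_units.

(** A parametrization of the last term of the filtration by a matrix space that does not depend on
    [Z], which bounds the dimension of that term uniformly. *)
Definition word_span (A : 'M[k]_(size (words N), \dim {:M})) : Z :=
  \sum_i \sum_j A i j *: word (nth [::] (words N) i) (phi (vbasis {:M})`_j).

Lemma word_span_linear : linear word_span.
Proof.
move=> c A B; rewrite /word_span scaler_sumr -big_split; apply: eq_bigr => i _ /=.
rewrite scaler_sumr -big_split; apply: eq_bigr => j _ /=.
by rewrite !mxE scalerDl scalerA.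
Qed.

Lemma word_linear w : linear (word w).
Proof.
elim: w => [|[i j] w IH] c u v //=.
by rewrite IH act_linear.
Qed.

Lemma word_spanP v : filt N v <-> exists A, word_span A = v.
Proof.
split=> [|[A <-]]; last first.
  have lf : lin_closed (filt N) := filt_lin N.
  apply: big_ind => [|x y|i _]; [by case: lf | exact: filtD |].
  apply: big_ind => [|x y|j _]; [by case: lf | exact: filtD |].
  by apply: filtZ; have [wN ow] := words_odd (mem_nth [::] (ltn_ord i)); apply: filt_word.
move=> h; apply: (h (fun v => exists A, word_span A = v)).
split=> [|c u w [A <-] [B <-]].
- by exists 0; rewrite (lin0 word_span_linear).
- by exists (c *: A + B); rewrite word_span_linear.
move=> w u wr ow; have wN := mem_words wr ow.
have [phil _ _] := phiP.
have iw : (index w (words N) < size (words N))%N by rewrite index_mem.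
exists (\matrix_(i, j) if i == Ordinal iw then coord (vbasis {:M}) j u else 0).
rewrite /word_span (bigD1 (Ordinal iw)) //= [X in _ + X]big1 ?addr0; last first.
  by move=> i /negPf iI; rewrite big1 // => j _; rewrite mxE iI scale0r.
rewrite {2}(coord_vbasis (memvf u)) (lin_sum phil) (lin_sum (word_linear _)).
apply: eq_bigr => j _; rewrite mxE eqxx nth_index //.
by rewrite (linZ phil) (linZ (word_linear _)).
Qed.

End Words.

(** * The induced module *)

Section Induction.
Local Open Scope ring_scope.
Variables (k : closedFieldType) (m n : nat).
Hypothesis char0 : [pchar k] =i pred0.
Variable M : fdsupermod (@glmn k m n).

Definition gen_by (X : fdsupermod (@glmn k m n)) (phi : M -> X) : Prop :=
  forall U : {vspace X}, subsupermod predT U -> (forall u, phi u \in U) ->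
  U = fullv.

Definition ind_bound : nat :=
  \dim {: 'M[k]_(size (words m n (size (odd_units m n))), \dim {:M})}.

Lemma linear_surj_dim (V W : vectType k) (f : V -> W) : linear f ->
  (forall w, exists v, f v = w) -> (\dim {:V} <= \dim {:W})%N ->
  \dim {:V} = \dim {:W} /\ injective f.
Proof.
move=> lf sf VW; pose h := linfun f.
have hE v : h v = f v by rewrite /h linfunEP.
have img : (h @: fullv = fullv)%VS.
  apply/eqP; rewrite eqEsubv subvf; apply/subvP => w _.
  by have [v <-] := sf w; rewrite -hE memv_img ?memvf.
have := limg_ker_dim h fullv; rewrite img capfv => dE.
have k0 : (\dim (lker h) = 0)%N by lia.
split; first by lia.
have /eqP/lker0P hi : lker h = 0%VS by apply/eqP; rewrite -dimv_eq0 k0.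
by move=> u v uv; apply: hi; rewrite !hE.
Qed.

(** The last term of the filtration is a submodule and the image of [word_span]; a complement of the
    kernel of [word_span] serves as its finite dimensional model. *)
Lemma generated_submodule (Z : supermod (@glmn k m n)) (phi : M -> Z) :
  shom (even_part glmn) M Z phi ->
  exists (X : fdsupermod (@glmn k m n)) (phi' : M -> X) (iota : X -> Z),
    [/\ shom glmn X Z iota, forall u, iota (phi' u) = phi u,
        shom (even_part glmn) M X phi', gen_by phi'
      & (\dim {:X} <= ind_bound)%N].
Proof.
move=> phiP; have spanP := word_spanP phiP.
have lS : linear (word_span phi) := @word_span_linear _ _ _ _ _ phi.
have [K KP] : exists K : {vspace 'M[k]_(_, _)},
    forall A, A \in K <-> word_span phi A = 0.
  apply: lin_vspace; split=> [|c A B A0 B0]; first exact: lin0 lS.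
  by rewrite lS A0 B0 scaler0 addr0.
pose W := subvs_of K^C%VS.
pose iota (w : W) : Z := word_span phi (vsval w).
have li : linear iota by move=> c u v; rewrite /iota linearP lS.
have ii : injective iota.
  move=> u v uv; apply: subvs_inj; apply/eqP; rewrite -subr_eq0 -memv0.
  rewrite -(capv_compl K) memv_cap; apply/andP; split; last first.
    by rewrite memvB // subvsP.
  by apply/KP; rewrite (linD lS) (linN lS) -/(iota u) -/(iota v) uv subrr.
have imP v : filt phi (size (odd_units m n)) v -> exists w, iota w = v.
  move=> /spanP[A <-].
  have : A \in (K + K^C)%VS by rewrite addv_complf memvf.
  case/memv_addP => a /KP a0 [b bC ->]; exists (Subvs bC).
  by rewrite /iota (linD lS) a0 add0r.
have filtW w : filt phi (size (odd_units m n)) (iota w).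
  by apply/spanP; exists (vsval w).
have [|x w _|pr [act [ax iotaP]]] := transport li ii.
- by move=> a w; apply: imP; apply: filt_pr.
- apply: imP; rewrite act_delta_sum; have [f0 fL] := filt_lin phi (size (odd_units m n)).
  apply: big_ind => [//|? ?|i _]; first exact: filtD.
  apply: big_ind => [//|? ?|j _]; first exact: filtD.
  by apply: filtZ; apply: filt_stationary.
pose X := FdSupermod ax.
have [phil phip phia] := phiP.
have /choice[phi' phi'E] u : exists w, iota w = phi u.
  by apply: imP; apply: (filt_word _ (w := [::])).
have [_ ip ia] := iotaP.
exists X, phi', iota; split=> //.
- split=> [c u v|a v|x v ex]; apply: ii.
  + by rewrite li !phi'E phil.
  + by rewrite ip !phi'E phip.
  + by rewrite ia // !phi'E phia.
- move=> U [prU actU] phiU; apply/eqP; rewrite eqEsubv subvf; apply/subvP => v _.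
  suff [u uU /ii <-//] : exists2 u, u \in U & iota u = iota v.
  apply: (filtW v (fun z => exists2 u, u \in U & iota u = z)).
    split=> [|c _ _ [u uU <-] [u' uU' <-]].
      by exists 0; rewrite ?mem0v ?(lin0 li).
    by exists (c *: u + u'); [rewrite memvD ?memvZ | exact: li].
  move=> w u _ _; elim: w => [|[i j] w [u' uU' /= <-]].
    by exists (phi' u).
  by exists (fd_act (delta_mx i j) u'); [exact: actU | exact: ia].
- rewrite /ind_bound; apply: (leq_trans (n := \dim K^C)); last exact/dimvS/subvf.
  by rewrite dimvf.
Qed.

Lemma gen_by_ext (X : fdsupermod (@glmn k m n)) (Z : supermod (@glmn k m n))
    (phi : M -> X) (f g : X -> Z) :
  gen_by phi -> shom glmn X Z f -> shom glmn X Z g ->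
  (forall u, f (phi u) = g (phi u)) -> f =1 g.
Proof.
move=> gX [lf pf af] [lg pg ag] fg v.
have [|U UP] := @lin_vspace _ X (fun v => f v = g v).
  split=> [|c u w fu fw]; first by rewrite (lin0 lf) (lin0 lg).
  by rewrite lf lg fu fw.
apply/UP; rewrite (gX U) ?memvf //; last by move=> u; apply/UP.
split=> [a u /UP fu|x u _ /UP fu]; apply/UP.
  by have := pf a u; have := pg a u; rewrite /= => -> ->; rewrite fu.
by have := af x u isT; have := ag x u isT; rewrite /= => -> ->; rewrite fu.
Qed.

Lemma gen_by_image (X X' : fdsupermod (@glmn k m n)) (phi : M -> X)
    (phi' : M -> X') (f : X' -> X) : gen_by phi -> shom glmn X' X f ->
  (forall u, f (phi' u) = phi u) -> forall v, exists w, f w = v.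
Proof.
move=> gX [lf pf af] fphi v.
have [|U UP] := @lin_vspace _ X (fun v => exists w, f w = v).
  split=> [|c _ _ [u <-] [w <-]]; first by exists 0; rewrite (lin0 lf).
  by exists (c *: u + w); rewrite lf.
apply/UP; rewrite (gX U) ?memvf //; last by move=> u; apply/UP; exists (phi' u).
split=> [a _ /UP[w <-]|x _ _ /UP[w <-]]; apply/UP.
  by exists (fd_pr a w); exact: pf.
by exists (fd_act x w); exact: af.
Qed.

(* The induced module [U(g) (x)_{U(g_0)} M], characterized by its universal
   property. Among the modules generated by an image of [M], which have bounded
   dimension, one of maximal dimension is universal: the submodule of its direct
   sum with any [Z] generated by the diagonal image of [M] projects onto it, hence
   isomorphically, and so yields a map to [Z]. *)
Lemma induced_module :
  exists (X : fdsupermod (@glmn k m n)) (phi : M -> X),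
    [/\ shom (even_part glmn) M X phi, gen_by phi
      & forall (Z : supermod (@glmn k m n)) (psi : M -> Z),
          shom (even_part glmn) M Z psi ->
          exists f : X -> Z, shom glmn X Z f /\ forall u, f (phi u) = psi u].
Proof.
pose cand d := exists (X : fdsupermod (@glmn k m n)) (phi : M -> X),
  [/\ shom (even_part glmn) M X phi, gen_by phi, \dim {:X} = d
    & (d <= ind_bound)%N].
have exc : exists d, `[< cand d >].
  have [|X [phi [_ [_ _ phiP gX dX]]]] := @generated_submodule M id.
    by split.
  by exists (\dim {:X}); apply/asboolP; exists X, phi.
have bc d : `[< cand d >] -> (d <= ind_bound)%N.
  by move=> /asboolP[? [? []]].
case: (ex_maxnP exc bc) => d /asboolP[X [phi [phiP gX dX _]]] dmax.
exists X, phi; split=> // Z psi psiP.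
have [pl pp pa] := phiP; have [ql qp qa] := psiP.
have [|Y [chi [iota [iotaP iE chiP gY dY]]]] :=
    @generated_submodule (sdsum (fd_supermod X) Z) (fun u => (phi u, psi u)).
  split=> [c u v|a v|x v ex] /=; first by rewrite pl ql.
  - by rewrite /sdsum_pr /=; congr pair; [exact: pp | exact: qp].
  - by rewrite /sdsum_act /=; congr pair; [exact: pa | exact: qa].
have [il ip ia] := iotaP.
pose h (y : Y) : X := (iota y).1.
have hP : shom glmn Y X h.
  split=> [c u v|a v|x v gx]; rewrite /h.
  - by rewrite il.
  - by have := ip a v; rewrite /= => ->.
  - by have := ia x v gx; rewrite /= => ->.
have [hl hp ha] := hP.
have hchi u : h (chi u) = phi u by rewrite /h iE.
have hs := gen_by_image gX hP hchi.
have [|_ hi] := linear_surj_dim hl hs.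
  by rewrite dX; apply: dmax; apply/asboolP; exists Y, chi.
have [r rE] := choice hs.
have hK y : r (h y) = y by apply: hi; rewrite rE.
have rl : linear r by move=> c u v; apply: hi; rewrite hl !rE.
exists (fun v => (iota (r v)).2); split; last by move=> u; rewrite -hchi hK iE.
split=> [c u v|a v|x v gx].
- by rewrite rl il.
- have -> : r (fd_pr a v) = fd_pr a (r v) by apply: hi; rewrite (hp a) !rE.
  by have := ip a (r v); rewrite /= => ->.
- have -> : r (fd_act x v) = fd_act x (r v) by apply: hi; rewrite (ha x) // !rE.
  by have := ia x (r v) gx; rewrite /= => ->.
Qed.

Lemma shomW (S S' : {pred 'M[k]_(m + n)}) (Z Z' : supermod (@glmn k m n))
    (f : Z -> Z') : {subset S' <= S} -> shom S Z Z' f -> shom S' Z Z' f.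
Proof. by move=> SS [lf pf af]; split=> // x v /SS; exact: af. Qed.

Lemma shom_comp (l : subsuper k m n) (S : {pred 'M[k]_(m + n)})
    (Z1 Z2 Z3 : supermod l) (f : Z2 -> Z3) (g : Z1 -> Z2) :
  shom S Z2 Z3 f -> shom S Z1 Z2 g -> shom S Z1 Z3 (f \o g).
Proof.
move=> [lf pf af] [lg pg ag]; split=> [|a v|x v Sx] /=.
- exact: lin_comp.
- by rewrite pg pf.
- by rewrite ag // af.
Qed.

(** Given a [g_0]-splitting [s], the universal property extends [s \o h \o phi] to a lift of [h];
    the two agree after [g] because they do on the generators. The projection [pi] extends the
    identity of [M], so [phi] is its section. *)
Lemma relative_cover :
  exists (X : fdsupermod (@glmn k m n)) (phi : M -> X) (pi : X -> M),
    [/\ rel_projective (fd_supermod X), shom glmn X M pi,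
        shom (even_part glmn) M X phi, cancel phi pi & gen_by phi].
Proof.
have [X [phi [phiP gX univ]]] := induced_module.
have [|pi [piP piE]] := univ M id; first by split.
exists X, phi, pi; split=> // M1 M2 M3 f g [[_ gP _ _ _] [s [sP sK]]] h hP.
have ev_sub : {subset even_part (@glmn k m n) <= glmn} by [].
have [|h' [h'P h'E]] := univ M2 (s \o (h \o phi)).
  apply: shom_comp sP _; apply: shom_comp phiP.
  exact: shomW ev_sub hP.
exists h'; split=> //; apply: gen_by_ext gX _ hP _.
  exact: shom_comp gP h'P.
by move=> u; rewrite /= h'E /= sK.
Qed.

End Induction.

(** * Complete reducibility *)

Section WeightOrder.
Local Open Scope ring_scope.
Variables (k : closedFieldType) (m n : nat).
Implicit Types (i j a b : 'I_(m + n)) (la nu mu S : 'I_(m + n) -> k).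

(** Adds to [la] the root of the matrix unit [(a, b)]. *)
Definition shift a b la i : k := la i + (i == a)%:R - (i == b)%:R.

Definition regular S : Prop :=
  forall i j, pos i j -> exists r, S i - S j = r.+1%:R.

Definition dominant la : Prop :=
  forall i j, pos i j -> exists r : nat, la i - la j = r%:R.

(* [nu - la] pairs positively with every regular dominant weight; this holds when
   it is a non-empty sum of positive roots. *)
Definition lt_wt la nu : Prop :=
  forall S, regular S -> exists r, \sum_i (nu i - la i) * S i = r.+1%:R.

(** A linear functional that every raising operator changes by a nonzero integer of constant sign,
    so that it measures progress in [raise]. *)
Definition wt_height la : k := \sum_i la i * i%:R.

Lemma sum_delta (F : 'I_(m + n) -> k) a : \sum_i (i == a)%:R * F i = F a.
Proof.
rewrite (bigD1 a) //= eqxx mul1r big1 ?addr0 // => i /negPf ->.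
by rewrite mul0r.
Qed.

Lemma lt_wt_up a b la : pos a b -> lt_wt la (shift a b la).
Proof.
move=> pab S /(_ _ _ pab)[r rE]; exists r; rewrite -rE -(sum_delta S a).
rewrite -(sum_delta S b) -sumrB; apply: eq_bigr => i _.
by rewrite /shift; ring.
Qed.

Lemma lt_wt_down a b la : pos a b -> lt_wt (shift b a la) la.
Proof.
move=> pab S /(_ _ _ pab)[r rE]; exists r; rewrite -rE -(sum_delta S a).
rewrite -(sum_delta S b) -sumrB; apply: eq_bigr => i _.
by rewrite /shift; ring.
Qed.

Lemma lt_wt_trans la mu nu : lt_wt la mu -> lt_wt mu nu -> lt_wt la nu.
Proof.
move=> h h' S rS; have [r rE] := h S rS; have [r' rE'] := h' S rS.
exists (r + r').+1; rewrite -addSn -addnS natrD -rE -rE' -big_split /=.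
by apply: eq_bigr => i _; ring.
Qed.

Lemma wt_height_shift a b la : (a < b)%N ->
  wt_height (shift a b la) = wt_height la - (b - a)%:R.
Proof.
move=> ab; rewrite natrB 1?ltnW // opprB addrA.
rewrite -[X in _ + X - _](sum_delta (fun i => (i : nat)%:R) a).
rewrite -(sum_delta (fun i => (i : nat)%:R) b) -big_split -sumrB.
by apply: eq_bigr => i _; rewrite /shift /=; ring.
Qed.

(** The scalar [(la, la + 2 rho)] by which the Casimir operator acts on a highest weight vector of
    weight [la]. *)
Definition casimir_wt la : k :=
  \sum_i \sum_j (if i == j then la i * la i
                 else if pos i j then la i - la j else 0).

(** The sum [2 rho] of the positive roots of [g_0]. *)
Definition rho2 i : k := \sum_j (pos i j)%:R - \sum_j (pos j i)%:R.

(** From [i] to a later index [j] of the same block, fewer positive roots start and more of them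
    end. *)
Lemma rho2_regular : regular rho2.
Proof.
move=> i j pij; rewrite /rho2 -!natr_sum.
have [ij pp] := andP pij.
have lt1 : (\sum_l (pos j l : nat) < \sum_l (pos i l : nat))%N.
  rewrite (bigD1 j) //= [ltnRHS](bigD1 j) //= pij posii add0n add1n ltnS.
  apply: leq_sum => l _; rewrite /pos; move: pp; rewrite (par_trans i j l).
  by case: (par i j) => //= _; case: (par j l) => //=; lia.
have lt2 : (\sum_l (pos l i : nat) < \sum_l (pos l j : nat))%N.
  rewrite (bigD1 i) //= [ltnRHS](bigD1 i) //= pij posii add0n add1n ltnS.
  apply: leq_sum => l _; rewrite /pos; move: pp; rewrite (par_trans l i j).
  by case: (par i j) => //= _; rewrite addbF; case: (par l i) => //=; lia.
move: lt1 lt2; set A := (\sum_l _)%N; set B := (\sum_l _)%N.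
set C := (\sum_l _)%N; set D := (\sum_l _)%N => AB CD.
exists ((B - A) + (D - C)).-1; rewrite prednK; last by lia.
rewrite natrD !natrB 1?ltnW //; ring.
Qed.

(* [|la + rho|^2 - |nu + rho|^2 = (la - nu, la + nu + 2 rho)] *)
Lemma casimir_wtB la nu : casimir_wt la - casimir_wt nu =
  \sum_i (la i - nu i) * (la i + nu i + rho2 i).
Proof.
have E mu : casimir_wt mu = \sum_i mu i * (mu i + rho2 i).
  have -> : casimir_wt mu = \sum_i (mu i * mu i + \sum_j (pos i j)%:R * (mu i - mu j)).
    apply: eq_bigr => i _; rewrite (bigD1 i) //= eqxx; congr (_ + _).
    rewrite [RHS](bigD1 i) //= posii mul0r add0r.
    apply: eq_bigr => j /negPf; rewrite eq_sym => ->.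
    by case: (pos i j); rewrite ?mul1r ?mul0r.
  rewrite big_split /=.
  have -> : \sum_i \sum_j (pos i j)%:R * (mu i - mu j) = \sum_i mu i * rho2 i.
    under eq_bigr => i _ do under eq_bigr => j _ do rewrite mulrBr.
    under eq_bigr => i _ do rewrite sumrB.
    rewrite sumrB [X in _ - X]exchange_big -sumrB; apply: eq_bigr => i _ /=.
    by rewrite -!mulr_suml mulrC /rho2 [RHS]mulrBr [X in _ - X]mulrC.
  rewrite -big_split; apply: eq_bigr => i _ /=.
  by rewrite [RHS]mulrDr.
by rewrite !E -sumrB; apply: eq_bigr => i _; ring.
Qed.

(** The difference is the pairing of [la - nu] with [la + nu + 2 rho], which is regular because
    [2 rho] is and both weights are dominant. *)
Lemma casimir_wt_lt la nu : dominant la -> dominant nu -> lt_wt nu la ->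
  exists r, casimir_wt la - casimir_wt nu = r.+1%:R.
Proof.
move=> dl dn lt; rewrite casimir_wtB; apply: lt => i j pij.
have [r rE] := dl i j pij; have [s sE] := dn i j pij.
have [t tE] := rho2_regular pij.
exists (r + s + t)%N; rewrite -addnS !natrD -rE -sE -tE; ring.
Qed.

End WeightOrder.

(** * Highest weight vectors and the Casimir operator of [g_0] *)

Section Weights.
Local Open Scope ring_scope.
Variables (k : closedFieldType) (m n : nat).
Hypothesis char0 : [pchar k] =i pred0.
Variable M : fdsupermod (@glmn k m n).
Implicit Types (i j a b : 'I_(m + n)) (la nu mu : 'I_(m + n) -> k) (v : M).

Local Notation e i j := (@fd_act _ _ _ _ M (delta_mx i j)).

Let le i j : linear (e i j) := fd_act_linear (M := M) (delta_mx i j).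
Let lp (p : bool) : linear (@fd_pr _ _ _ _ M p) := pr_lin (fd_axiom M) p.

Definition wt la v : Prop := forall i, e i i v = la i *: v.

Lemma torus_swap i a b v :
  e i i (e a b v) = e a b (e i i v) + ((i == a)%:R - (i == b)%:R) *: e a b v.
Proof.
rewrite (fd_act_even_delta _ _ _ (parii i)) scalerBl; congr (_ + (_ - _)).
  by case: eqP => [->|_]; rewrite ?scale0r.
by rewrite eq_sym; case: eqP => [->|_]; rewrite ?scale0r.
Qed.

Lemma wt_shift la a b v : wt la v -> wt (shift a b la) (e a b v).
Proof.
move=> lv i; rewrite torus_swap lv (linZ (le a b)) -scalerDl.
by rewrite /shift addrA.
Qed.

Lemma wt_uniq la nu v : v != 0 -> wt la v -> wt nu v -> la = nu.
Proof.
move=> v0 lv nv; apply: funext => i; apply/eqP; rewrite -subr_eq0.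
have /eqP : (la i - nu i) *: v = 0 by rewrite scalerBl -lv -nv subrr.
by rewrite scaler_eq0 (negPf v0) orbF.
Qed.

Lemma weightv_wt v : weightv v -> exists la, wt la v.
Proof.
move=> [_ vt].
have /choice[la laE] i : exists c, e i i v = c *: v.
  apply: vt; rewrite inE; apply/is_diag_mxP => a b ab; rewrite mxE.
  by case: andP => // -[/eqP ai /eqP bi]; rewrite ai bi eqxx in ab.
by exists la.
Qed.

(** As long as some raising operator keeps the vector outside [V'], it is applied; each application
    lowers the eigenvalue of [h] by a positive integer, which [eigen_bounded] allows only finitely
    often. [Q] carries the invariants wanted by the application. *)
Lemma raise (V' : {vspace M}) (Q : ('I_(m + n) -> k) -> M -> Prop) la v :
  (forall mu u, Q mu u -> wt mu u) ->
  (forall mu u a b, pos a b -> Q mu u -> Q (shift a b mu) (e a b u)) ->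
  Q la v -> v \notin V' ->
  exists mu u, [/\ Q mu u, u \notin V' & forall a b, pos a b -> e a b u \in V'].
Proof.
move=> Qw Qs; pose h (u : M) : M := \sum_(i < m + n) i%:R *: e i i u.
have hL : linear h.
  move=> c u w; rewrite scaler_sumr -big_split; apply: eq_bigr => i _ /=.
  by rewrite le scalerDr !scalerA mulrC.
have hE mu u : wt mu u -> h u = wt_height mu *: u.
  move=> wu; rewrite scaler_suml; apply: eq_bigr => i _.
  by rewrite wu scalerA mulrC.
have [N NP] := eigen_bounded char0 (wt_height la) hL.
suff main d r mu u : (N <= r + d)%N -> wt_height mu = wt_height la - r%:R ->
    Q mu u -> u \notin V' ->
    exists mu u, [/\ Q mu u, u \notin V' & forall a b, pos a b -> e a b u \in V'].
  by apply: (main N 0%N); rewrite ?subr0.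
elim: d r mu u => [|d IH] r mu u Nr hmu Qu uV.
  have u0 : u = 0 by apply: (NP r); rewrite ?(hE mu) ?hmu //; [lia | exact: Qw].
  by rewrite u0 mem0v in uV.
case: (pselect (forall a b, pos a b -> e a b u \in V')) => [?|no].
  by exists mu, u.
have [a [b [pab nab]]] : exists a b, pos a b /\ e a b u \notin V'.
  apply: contrapT => no'; apply: no => a b pab.
  by apply/negPn/negP => nab; apply: no'; exists a, b.
have ab : (a < b)%N by case/andP: pab.
apply: (IH (r + (b - a))%N (shift a b mu) (e a b u)) => //; first by lia.
  by rewrite wt_height_shift // hmu natrD opprD addrA.
exact: Qs.
Qed.

Definition ev_sub (U : {vspace M}) : Prop := subsupermod (even_part glmn) U.

Lemma ev_subP U : ev_sub U <->
  (forall p v, v \in U -> fd_pr p v \in U) /\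
  (forall i j v, par i j = false -> v \in U -> e i j v \in U).
Proof.
split=> -[prU actU]; split=> //.
  move=> i j v pij; apply: actU; rewrite inE /= -pij; exact: homog_delta.
move=> x v; rewrite inE /= => px vU.
by apply: (fd_homog_mem (memv_lin_closed U) px) => i j pij; apply: actU.
Qed.

Lemma wt_dominant (V' : {vspace M}) nu y : ev_sub V' -> wt nu y ->
  y \notin V' -> (forall a b, pos a b -> e a b y \in V') -> dominant nu.
Proof.
move=> /ev_subP[_ eV] wy yV ny i j pij.
have ij0 := par_pos pij; have ji0 : par j i = false by rewrite parC.
have ij : (i == j) = false by case/andP: pij => /ltn_eqF.
have hE v : fd_act (delta_mx i i - delta_mx j j) v = e i i v - e j j v.
  exact: fd_actBl.
have [|||||||r [r0 _]] := @sl2_highest _ char0 _ V' (e i j) (e j i)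
  (@fd_act _ _ _ _ M (delta_mx i i - delta_mx j j)) (nu i - nu j) y (le _ _) (le _ _)
  (fd_act_linear (M := M) _).
- by move=> v; rewrite (fd_act_even_delta _ _ _ ij0) !eqxx !scale1r hE.
- move=> v; rewrite !hE !torus_swap !eqxx ij eq_sym ij.
  rewrite (linD (le j i)) (linN (le j i)) sub0r subr0.
  rewrite !scaleN1r scale1r scaler_nat mulr2n !opprD !addrA.
  by rewrite [LHS](ACl (1*3*2*4)).
- by move=> v; apply: eV.
- by move=> v; apply: eV.
- by [].
- exact: ny.
- by rewrite hE !wy scalerBl.
by exists r.
Qed.

(** The Casimir operator of [gl(m) + gl(n)] for the trace form on each block; odd pairs of units are
    left out. *)
Definition casimir (v : M) : M :=
  \sum_i \sum_j (~~ par i j)%:R *: e i j (e j i v).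

Lemma casimir_linear : linear casimir.
Proof.
move=> c u v; rewrite scaler_sumr -big_split; apply: eq_bigr => i _ /=.
rewrite scaler_sumr -big_split; apply: eq_bigr => j _ /=.
by rewrite (le j i) (le i j) scalerDr !scalerA mulrC.
Qed.

Lemma casimir_pr p v : fd_pr p (casimir v) = casimir (fd_pr p v).
Proof.
rewrite (lin_sum (lp p)); apply: eq_bigr => i _.
rewrite (lin_sum (lp p)); apply: eq_bigr => j _; rewrite (linZ (lp p)).
rewrite !(fd_pr_act _ _ (homog_delta _ _ _)) -addbA [par j i]parC.
by case: (par i j); rewrite ?addbF.
Qed.

Lemma sum_scale_delta (F : 'I_(m + n) -> M) b : \sum_j (b == j)%:R *: F j = F b.
Proof.
rewrite (bigD1 b) //= eqxx scale1r big1 ?addr0 // => j.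
by rewrite eq_sym => /negPf ->; rewrite scale0r.
Qed.

Lemma casimir_comm a b v : par a b = false ->
  e a b (casimir v) = casimir (e a b v).
Proof.
move=> pab.
pose c i j : k := (~~ par i j)%:R.
have step i j : c i j *: e a b (e i j (e j i v)) =
    c i j *: e i j (e j i (e a b v)) +
   (((b == j)%:R *: (c i j *: e i j (e a i v))
     - (i == a)%:R *: (c i j *: e i j (e j b v)))
   + ((b == i)%:R *: (c i j *: e a j (e j i v))
     - (j == a)%:R *: (c i j *: e i b (e j i v)))).
  rewrite (fd_act_even_delta i j _ pab) (fd_act_even_delta j i _ pab).
  rewrite !(linD (le _ _)) !(linN (le _ _)) !(linZ (le _ _)).
  rewrite !scalerDr !scalerN !scalerA ![_ * c i j]mulrC.
  by rewrite !addrA.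
rewrite (lin_sum (le a b)).
under eq_bigr => i _ do rewrite (lin_sum (le a b)).
under eq_bigr => i _ do under eq_bigr => j _ do rewrite (linZ (le a b)) step.
under eq_bigr => i _ do rewrite !big_split !sumrN /=.
rewrite !big_split !sumrN /= -[RHS]addr0; congr (_ + _).
under eq_bigr => i _ do rewrite sum_scale_delta.
under [X in _ - X + _]eq_bigr => i _ do rewrite -scaler_sumr eq_sym.
under [X in _ + (X - _)]eq_bigr => i _ do rewrite -scaler_sumr.
under [X in _ + (_ - X)]eq_bigr => i _ do under eq_bigr => j _ do rewrite eq_sym.
under [X in _ + (_ - X)]eq_bigr => i _ do rewrite sum_scale_delta.
rewrite !sum_scale_delta.
(* As [a] and [b] lie in the same block, the coefficients agree and the four correction sums cancel
   in pairs. *)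
have cE i : (c b i = c a i) * (c i b = c i a).
  rewrite /c (parC i b) (parC i a) (par_trans a b i) pab.
  by case: (par b i).
under [X in _ - _ + (X - _)]eq_bigr => i _ do rewrite cE.
under [X in X - _ + _]eq_bigr => i _ do rewrite cE.
by rewrite addrC addrA subrK subrr.
Qed.

Lemma casimir_mem (U : {vspace M}) v : ev_sub U -> v \in U -> casimir v \in U.
Proof.
move=> /ev_subP[_ eU] vU; rewrite memv_suml // => i _.
rewrite memv_suml // => j _; case pij: (par i j); first by rewrite scale0r mem0v.
by rewrite memvZ // !eU // parC.
Qed.

(** Raising operators are moved to the right, where they land in [V']; what remains are the squares
    from the diagonal units and the commutators [e_ii - e_jj]. *)
Lemma casimir_highest (V' : {vspace M}) nu y : ev_sub V' -> wt nu y ->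
  (forall a b, pos a b -> e a b y \in V') ->
  casimir y - casimir_wt nu *: y \in V'.
Proof.
move=> /ev_subP[_ eV] wy ny; rewrite /casimir /casimir_wt scaler_suml -sumrB.
rewrite memv_suml // => i _; rewrite scaler_suml -sumrB memv_suml // => j _.
case: (eqVneq i j) => [<-|ij].
  by rewrite parii scale1r wy (linZ (le i i)) wy scalerA subrr mem0v.
case pij: (par i j).
  by rewrite /pos pij andbF scale0r scale0r subr0 mem0v.
have pji : par j i = false by rewrite parC.
rewrite scale1r; case: (ltngtP i j) => [lij|lji|/val_inj E]; last by rewrite E eqxx in ij.
  have pos_ij : pos i j by rewrite /pos lij pij.
  rewrite pos_ij (fd_act_even_delta _ _ _ pij) !eqxx !scale1r !wy -scalerBl addrK.
  by rewrite eV // ny.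
have pos_ji : pos j i by rewrite /pos lji pji.
by rewrite /pos ltnNge (ltnW lji) /= scale0r subr0 eV // ny.
Qed.

Lemma ev_sub0 : ev_sub 0%VS.
Proof.
apply/ev_subP; split=> [p v|i j v _]; rewrite !memv0 => /eqP ->.
  by rewrite (lin0 (lp p)).
by rewrite (lin0 (le i j)).
Qed.

Lemma exists_highest (U : {vspace M}) : ev_sub U -> U != 0%VS ->
  exists la v, [/\ wt la v, v \in U, v \notin 0%VS
    & forall a b, pos a b -> e a b v \in 0%VS].
Proof.
move=> sU U0.
have [|v [vU v0 vw]] := @common_weight k m n M (enum 'I_(m + n)) U U0.
  move=> t v ht; have [_ aU] := sU; apply: aU.
  by rewrite inE /= torus_even.
have /choice[la wv] i : exists c, e i i v = c *: v by apply: vw; rewrite mem_enum.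
have [||||mu [u [[wu uU] u0 nu]]] := @raise 0%VS (fun mu u => wt mu u /\ u \in U) la v.
- by move=> ? ? [].
- move=> mu u a b pab [wu uU]; split; first exact: wt_shift.
  by have /ev_subP[_ eU] := sU; rewrite eU // par_pos.
- by split.
- by rewrite memv0.
by exists mu, u.
Qed.

Lemma wt_span_mem (X : seq M) la z : (forall x, x \in X -> exists nu, wt nu x) ->
  wt la z -> z \in <<X>>%VS -> z \in <<[seq x <- X | `[< wt la x >]]>>%VS.
Proof.
elim: X z => [|x X IH] z wX wz //=.
rewrite span_cons => /memv_addP[_ /vlineP[c ->] [w wX' zE]].
have wX1 y : y \in X -> exists nu, wt nu y by move=> yX; apply: wX; rewrite inE yX orbT.
case: asboolP => [wx|nwx].
  have wE : w = z - c *: x by rewrite zE addrAC subrr add0r.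
  rewrite zE span_cons memv_add ?memvZ ?memv_line //; apply: IH => //.
  move=> i; rewrite wE (linD (le i i)) (linN (le i i)) (linZ (le i i)) wz wx.
  by rewrite scalerBr !scalerA mulrC.
have [mu wx] := wX x (mem_head _ _).
have [i ne] : exists i, mu i != la i.
  apply: contrapT => no; apply: nwx => i; rewrite wx; congr (_ *: _).
  by apply/eqP/negPn/negP => h; apply: no; exists i.
(* [p] fixes vectors of weight [la], annihilates [x] and rescales the other weight vectors, so
   applying it to [z] drops [x] from the spanning list. *)
apply: IH => //; pose p u := (la i - mu i)^-1 *: (e i i u - mu i *: u).
have pl : linear p.
  move=> d u u'; rewrite /p (le i i) [mu i *: (_ + _)]scalerDr opprD addrACA.
  rewrite scalerDr; congr (_ + _).
  by rewrite !scalerBr !scalerA; congr (_ *: _ - _ *: _); ring.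
have pz : p z = z.
  by rewrite /p wz -scalerBl scalerA mulVf ?scale1r // subr_eq0 eq_sym.
have px : p x = 0 by rewrite /p wx subrr scaler0.
rewrite -pz zE (linD pl) (linZ pl) px scaler0 add0r.
apply: lin_span pl _ _ wX' => y yX; have [eta wy] := wX1 y yX.
by rewrite /p wy -scalerBl !memvZ ?memv_span.
Qed.

(** The centre of the reductive [g_0] could otherwise act by Jordan blocks, and complete
    reducibility would fail. *)
Hypothesis weight_span : forall U : {vspace M},
  (forall v, weightv v -> v \in U) -> U = fullv.

(** A highest weight vector of the quotient by [V'], represented by a homogeneous vector of exact
    weight in [M]. *)
Definition relative_highest (V' : {vspace M}) nu y : Prop :=
  [/\ wt nu y, exists p, fd_pr p y = y, y \notin V'
    & forall a b, pos a b -> e a b y \in V'].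

Lemma relative_highest_exists (V' : {vspace M}) : V' != fullv ->
  exists nu y, relative_highest V' nu y.
Proof.
move=> /eqP Vf.
have [v [wv vV]] : exists v, weightv v /\ v \notin V'.
  apply: contrapT => no; apply: Vf; apply: weight_span => v wv.
  by apply/negPn/negP => nv; apply: no; exists v.
have [[p pv] _] := wv; have [la wl] := weightv_wt wv.
have [||||mu [u [[wu pu] uV nu]]] :=
  @raise V' (fun mu u => wt mu u /\ fd_pr p u = u) la v; first by move=> ? ? [].
- move=> mu u a b pab [wu pu]; split; first exact: wt_shift.
  by rewrite (fd_pr_act _ _ (homog_delta _ a b)) (par_pos pab) addbF pu.
- by split.
- by [].
by exists mu, u; split=> //; exists p.
Qed.

Definition ev_endo (f : M -> M) : Prop :=
  [/\ linear f, forall p v, fd_pr p (f v) = f (fd_pr p v)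
    & forall i j v, par i j = false -> e i j (f v) = f (e i j v)].

Lemma casimir_endo c : ev_endo (fun v => casimir v - c *: v).
Proof.
split=> [d u v|p v|i j v pij].
- by rewrite casimir_linear scalerDr opprD addrACA !scalerA mulrC -scalerA scalerBr.
- by rewrite (linD (lp p)) (linN (lp p)) (linZ (lp p)) casimir_pr.
- by rewrite (linD (le i j)) (linN (le i j)) (linZ (le i j)) casimir_comm.
Qed.

Lemma ev_sub_img (f : M -> M) (U : {vspace M}) : ev_endo f -> ev_sub U ->
  ev_sub (linfun f @: U)%VS.
Proof.
move=> [lf pf ef] /ev_subP[pU eU]; apply/ev_subP.
split=> [p v|i j v pij] /memv_imgP[u uU ->]; rewrite linfunEP //.
  by rewrite pf -(linfunEP lf) memv_img ?pU.
by rewrite ef // -(linfunEP lf) memv_img ?eU.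
Qed.

Lemma ev_sub_ker (f : M -> M) (U : {vspace M}) : ev_endo f -> ev_sub U ->
  ev_sub (U :&: lker (linfun f))%VS.
Proof.
move=> [lf pf ef] /ev_subP[pU eU]; apply/ev_subP.
split=> [p v|i j v pij]; rewrite !memv_cap => /andP[vU]; rewrite !memv_ker !linfunEP //.
  by move=> /eqP fv; rewrite pU // -pf fv (lin0 (lp p)) eqxx.
by move=> /eqP fv; rewrite eU // -ef // fv (lin0 (le i j)) eqxx.
Qed.

(* The span of [y] and of its images under lowering operators is already stable
   under [g_0]. *)
Lemma highest_generated (U : {vspace M}) nu y : ev_sub U -> y \in U ->
  wt nu y -> (exists p, fd_pr p y = y) -> (forall a b, pos a b -> e a b y = 0) ->
  (forall U', ev_sub U' -> y \in U' -> (U' <= U)%VS -> U' = U) ->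
  forall D : {vspace M}, y \in D ->
  (forall a b v, pos a b -> v \in D -> e b a v \in D) -> (U <= D)%VS.
Proof.
move=> sU yU wy [p0 py] ny minU.
pose stable (D : {vspace M}) := y \in D /\
  forall a b v, pos a b -> v \in D -> e b a v \in D.
have [|B BP] := @lin_vspace _ M (fun v => forall D, stable D -> v \in D).
  by split=> [D _|c u v hu hv D sD]; rewrite ?mem0v // memvD ?memvZ ?hu ?hv.
have yB : y \in B by apply/BP => D [].
have lowB a b v : pos a b -> v \in B -> e b a v \in B.
  by move=> pab /BP vB; apply/BP => D sD; have [_ h] := sD; apply/h/vB.
have Bmin (Q : M -> Prop) : lin_closed Q -> Q y ->
    (forall a b v, pos a b -> v \in B -> Q v -> Q (e b a v)) ->
    forall v, v \in B -> Q v.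
  move=> [Q0 QL] Qy Qlow v vB.
  have [|D DP] := @lin_vspace _ M (fun v => v \in B /\ Q v).
    split=> [|c u w [uB Qu] [wB Qw]]; first by rewrite mem0v.
    by rewrite memvD ?memvZ //; split=> //; apply: QL.
  have : v \in D.
    move/BP: vB; apply; split; first exact/DP.
    by move=> a b w pab /DP[wB Qw]; apply/DP; split; [apply: lowB | apply: Qlow].
  by case/DP.
have upB i j v : par i j = false -> v \in B -> e i j v \in B.
  move=> pij vB; case: (boolP (pos j i)) => [pji|npji]; first exact: lowB.
  (* All units on or above the diagonal are treated at once, since commuting one past a lowering
     operator changes its indices. *)
  suff: forall s t : 'I_(m + n), (s <= t)%N -> par s t = false -> e s t v \in B.
    by apply=> //; move: npji; rewrite /pos parC pij andbT -leqNgt.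
  apply: (Bmin (fun v => forall s t : 'I_(m + n), (s <= t)%N -> par s t = false ->
    e s t v \in B) _ _ _ v vB).
  - split=> [a b _ _|c u w hu hw a b ab pab]; first by rewrite (lin0 (le a b)) mem0v.
    by rewrite (le a b) memvD ?memvZ ?hu ?hw.
  - move=> a b; rewrite leq_eqVlt => /orP[/eqP/val_inj <- _|ab pab].
      by rewrite wy memvZ.
    by rewrite ny ?mem0v // /pos ab pab.
  - move=> {npji}a b w pab wB hw {}i {}j ij {}pij.
    rewrite (fd_act_even_delta _ _ _ pij) memvD ?(lowB _ _ _ pab) ?hw //.
    have evB s t : par s t = false -> e s t w \in B.
      move=> pst; case: (ltnP t s) => ts; last exact: hw.
      by apply: lowB => //; rewrite /pos ts parC pst.
    have pab0 := par_pos pab.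
    rewrite memvB //; [case: eqP => [jb|_] | case: eqP => [ai|_]];
      rewrite ?scale0r ?mem0v // scale1r evB //.
      by rewrite (par_trans i b a) -{1}jb pij parC pab0.
    by rewrite (par_trans b a j) parC pab0 ai pij.
have sB : ev_sub B.
  apply/ev_subP; split=> // p v vB; apply: (Bmin (fun v => fd_pr p v \in B) _ _ _ v vB).
  - split=> [|c u w hu hw]; first by rewrite (lin0 (lp p)) mem0v.
    by rewrite (lp p) memvD ?memvZ.
  - by rewrite -py (pr_pr (fd_axiom M)) py; case: ifP; rewrite ?mem0v.
  - move=> a b w pab wB hw; rewrite (fd_pr_act _ _ (homog_delta _ b a)).
    by rewrite parC (par_pos pab) addbF lowB.
have /ev_subP[_ eU] := sU.
have BU : (B <= U)%VS.
  apply/subvP => v /BP; apply; split=> // a b w pab; apply: eU.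
  by rewrite parC par_pos.
move=> D yD lowD; rewrite -(minU B sB yB BU).
by apply/subvP => v /BP; apply.
Qed.

(* [U] is chosen of minimal dimension among the submodules containing a weight
   vector [y] outside of [V'] that is a highest weight vector modulo [V'].
   By minimality [T = casimir - casimir_wt nu] has no nonzero eigenvalue on [U],
   so that the highest weights of [U] have the same Casimir value as [nu], and no
   weight strictly comparable with [nu] does. *)
Theorem simple_complement (V' : {vspace M}) : ev_sub V' -> V' != fullv ->
  exists U, simple_sub (even_part glmn) U /\ (U :&: V' = 0)%VS.
Proof.
move=> sV Vf; have /ev_subP[pV eV] := sV.
pose P d := exists (U : {vspace M}) nu y,
  [/\ ev_sub U, y \in U, relative_highest V' nu y & \dim U = d].
have exP : exists d, `[< P d >].
  have [nu [y hy]] := relative_highest_exists Vf.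
  exists (\dim {:M}); apply/asboolP; exists fullv, nu, y; rewrite memvf; split=> //.
  by apply/ev_subP; split=> *; rewrite memvf.
case: (ex_minnP exP) => d /asboolP[U [nu [y [sU yU hy dU]]]] dmin.
have minU U' nu' y' : ev_sub U' -> y' \in U' -> relative_highest V' nu' y' ->
    (U' <= U)%VS -> U' = U.
  move=> sU' yU' hy' UU; apply/eqP; rewrite eqEdim UU dU.
  by apply: dmin; apply/asboolP; exists U', nu', y'.
have /ev_subP[pU eU] := sU.
have [wy py yV ny] := hy.
have dom_nu : dominant nu := wt_dominant sV wy yV ny.
pose T v := casimir v - casimir_wt nu *: v.
have Tendo : ev_endo T := casimir_endo _.
have [lT _ _] := Tendo.
have TyV : T y \in V' by exact: casimir_highest.
have TVV v : v \in V' -> T v \in V'.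
  by move=> vV; rewrite memvB ?memvZ ?casimir_mem.
(* If [c] were nonzero, [f = T - c] would send [y] to [- c y] modulo [V'], again relatively highest,
   so that [f(U) = U] by minimality; but [f] kills [w]. *)
have nil c w : w \in U -> w != 0 -> T w = c *: w -> c = 0.
  move=> wU w0 Tw; apply/eqP/negPn/negP => c0.
  pose f v := casimir v - (casimir_wt nu + c) *: v.
  have fE v : f v = T v - c *: v by rewrite /f scalerDl opprD addrA.
  have fendo : ev_endo f := casimir_endo _.
  have [lf pf ef] := fendo.
  have : (linfun f @: U)%VS = U.
    apply: (minU _ nu (f y)) (ev_sub_img fendo sU) _ _ _.
    - by rewrite -(linfunEP lf) memv_img.
    - split.
      + by move=> i; rewrite ef ?parii // wy (linZ lf).
      + by have [p pyE] := py; exists p; rewrite pf pyE.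
      + apply: contra yV; rewrite fE => h.
        have : c *: y \in V' by rewrite -(subKr (T y) (c *: y)) memvB.
        by move=> /(memvZ c^-1); rewrite scalerA mulVf // scale1r.
      + move=> a b pab; rewrite ef ?par_pos // fE.
        by rewrite memvB ?memvZ ?TVV ?ny.
    - apply/subvP => _ /memv_imgP[v vU ->]; rewrite linfunEP // /f.
      by rewrite memvB ?memvZ ?casimir_mem.
  move=> imU; have := limg_ker_dim (linfun f) U; rewrite imU => dE.
  have : (U :&: lker (linfun f))%VS = 0%VS by apply/eqP; rewrite -dimv_eq0; lia.
  move/eqP; apply/negP; apply: contraNneq w0 => K0; rewrite -memv0 -K0 memv_cap wU.
  by rewrite memv_ker linfunEP // fE Tw subrr eqxx.
(* Otherwise raising [e a b y] ends at a highest weight vector of [U] with weight above [nu]; its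
   Casimir value differs from that of [nu], against [nil]. *)
have top0 : forall a b, pos a b -> e a b y = 0.
  move=> a b pab; apply/eqP/negPn/negP => ey0.
  have [||||la [z [[wz zU lz] z0 nz]]] :=
    @raise 0%VS (fun mu u => [/\ wt mu u, u \in U & lt_wt nu mu]) (shift a b nu) (e a b y).
  - by move=> ? ? [].
  - move=> mu u i j pij [wu uU lu]; split; first exact: wt_shift.
      by rewrite eU // par_pos.
    exact: lt_wt_trans lu (lt_wt_up _ pij).
  - split; [exact: wt_shift | by rewrite eU // par_pos | exact: lt_wt_up].
  - by rewrite memv0.
  have dom_la := wt_dominant ev_sub0 wz z0 nz.
  have [r rE] := casimir_wt_lt dom_la dom_nu lz.
  have : casimir_wt la - casimir_wt nu = 0.
    apply: nil zU _ _; first by rewrite -memv0.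
    have := casimir_highest ev_sub0 wz nz; rewrite memv0 subr_eq0 => /eqP cz.
    by rewrite /T cz scalerBl.
  by move=> /eqP; rewrite rE char0_natr_eq0.
have Ty : T y = 0.
  apply/eqP; rewrite -memv0; apply: (casimir_highest ev_sub0 wy).
  by move=> a b pab; rewrite top0 ?mem0v.
have TU v : v \in U -> T v = 0.
  have <- : (U :&: lker (linfun T))%VS = U.
    apply: minU (ev_sub_ker Tendo sU) _ hy (capvSl _ _).
    by rewrite memv_cap yU memv_ker linfunEP // Ty eqxx.
  by rewrite memv_cap memv_ker linfunEP // => /andP[_ /eqP].
have simpleU : simple_sub (even_part glmn) U.
  split=> //.
    apply: contraNneq yV => U0; move: yU; rewrite U0 memv0 => /eqP ->.
    exact: mem0v.
  move=> X sX XU; case: (eqVneq X 0%VS) => [->|X0]; [by left | right].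
  have [la [z [wz zX z0 nz]]] := exists_highest sX X0.
  have zU := subvP XU _ zX.
  have dom_la := wt_dominant ev_sub0 wz z0 nz.
  have cas_eq : casimir_wt la = casimir_wt nu.
    have := casimir_highest ev_sub0 wz nz; rewrite memv0 subr_eq0 => /eqP cz.
    apply/eqP; rewrite -subr_eq0; move: (TU z zU); rewrite /T cz -scalerBl => /eqP.
    by rewrite scaler_eq0 -[z == 0]memv0 (negPf z0) orbF.
  have not_lt : ~ lt_wt la nu.
    move=> /(casimir_wt_lt dom_nu dom_la)[r]; rewrite cas_eq subrr => /eqP.
    by rewrite eq_sym char0_natr_eq0.
  (* [U] lies in the line of [y] plus the span of vectors of weight below [nu]. As [la] is not below
     [nu], the vector [z] falls on that line, so [X] contains [y]. *)
  have [E [_ EQ QE]] := max_free (fun v => exists mu, wt mu v /\ lt_wt mu nu).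
  have UD : (U <= <[y]> + <<E>>)%VS.
    apply: (highest_generated sU yU wy py top0) => [U' sU' yU' UU'||a b v pab].
    - exact: minU sU' yU' hy UU'.
    - by apply: (subvP (addvSl _ _)); apply: memv_line.
    case/memv_addP => _ /vlineP[c ->] [w wE ->].
    rewrite (linD (le b a)) (linZ (le b a)).
    apply: (subvP (addvSr _ _)); rewrite memvD ?memvZ //.
      apply: QE; exists (shift b a nu); split; first exact: wt_shift.
      exact: lt_wt_down.
    apply: lin_span (le b a) _ _ wE => u /EQ[mu [wu lu]]; apply: QE.
    exists (shift b a mu); split; first exact: wt_shift.
    exact: lt_wt_trans (lt_wt_down _ pab) lu.
  have : z \in <[y]>%VS.
    have := subvP UD _ zU; rewrite -span_cons => /(wt_span_mem _ wz) h.
    apply: subvP (h _); last first.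
      by move=> x; rewrite inE => /orP[/eqP ->|/EQ[mu []]]; [exists nu | exists mu].
    apply/span_subvP => x; rewrite mem_filter inE.
    case/andP=> /asboolP wx /orP[/eqP ->|/EQ[mu [wx' lx]]].
      exact: memv_line.
    case: (eqVneq x 0) => [->|x0]; first exact: mem0v.
    by case: not_lt; rewrite (wt_uniq x0 wx wx').
  case/vlineP => c zE; apply: minU sX _ hy XU.
  have c0 : c != 0 by apply: contraNneq z0 => c0; rewrite zE c0 scale0r mem0v.
  by move: (memvZ c^-1 zX); rewrite zE scalerA mulVf // scale1r.
exists U; split=> //; have [_ _ minS] := simpleU.
have [||//|] := minS (U :&: V')%VS; last 1 first.
- by move=> UV; move: yV; rewrite (subvP (capvSr U V')) // UV.
- by apply/ev_subP; split=> [p v|i j v pij]; rewrite !memv_cap => /andP[vU vV];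
    rewrite ?pU ?pV ?eU ?eV.
- exact: capvSl.
Qed.

(** Simple submodules meeting the current sum trivially are added one at a time; each is nonzero, so
    the sum is everything before [d] exceeds the dimension. *)
Theorem weight_completely_reducible : completely_reducible (even_part glmn) M.
Proof.
suff main d : exists r (W : 'I_r -> {vspace M}),
    [/\ forall s, simple_sub (even_part glmn) (W s), directv (\sum_s W s)
      & (\sum_s W s)%VS = fullv \/ (d <= \dim (\sum_s W s)%VS)%N].
  have [r [W [sW dW]]] := main (\dim {:M}).+1.
  case=> [fW|]; first by exists r, W.
  by rewrite ltnNge dimvS ?subvf.
elim: d => [|d [r [W [sW dW fW]]]].
  exists 0%N, (fun _ => 0%VS); split=> [[]//||]; last by right.
  by apply/directv_sumP => -[].
case: (eqVneq (\sum_s W s)%VS fullv) => [fW'|nf]; first by exists r, W; split=> //; left.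
have [|U [sU UW]] := simple_complement _ nf.
  apply/ev_subP; split=> [p v|i j v pij] /memv_sumP[u uW ->].
    rewrite (lin_sum (lp p)) memv_sumr // => s _.
    by have [/ev_subP[pW _] _ _] := sW s; apply/pW/uW.
  rewrite (lin_sum (le i j)) memv_sumr // => s _.
  by have [/ev_subP[_ eW] _ _] := sW s; apply: eW => //; apply: uW.
exists r.+1, (fun s => if unlift ord0 s is Some j then W j else U).
have sumE : (\sum_(s < r.+1) (if unlift ord0 s is Some j then W j else U) =
    U + \sum_s W s)%VS.
  rewrite big_ord_recl unlift_none; congr (_ + _)%VS.
  by apply: eq_bigr => s _; rewrite liftK.
have dimE : (\dim (U + \sum_s W s)%VS = \dim U + \dim (\sum_s W s)%VS)%N.
  by rewrite dimv_disjoint_sum.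
split.
- by move=> s; case: unliftP.
- rewrite directvE /= sumE dimE big_ord_recl unlift_none /= eqn_add2l.
  by rewrite (directvP dW) /=; apply/eqP; apply: eq_bigr => s _; rewrite liftK.
- right; rewrite sumE dimE.
  case: fW => [fW|dle]; first by rewrite fW eqxx in nf.
  by have [_ U0 _] := sU; rewrite -dimv_eq0 in U0; lia.
Qed.

End Weights.

(** * The stable categories *)

Section StableCategory.
Local Open Scope ring_scope.
Variables (k : closedFieldType) (m n : nat).
Hypothesis char0 : [pchar k] =i pred0.

Lemma weightv_act_delta (X : fdsupermod (@glmn k m n)) (i j : 'I_(m + n)) (v : X) :
  weightv v -> weightv (fd_act (delta_mx i j) v : X).
Proof.
move=> [[a va] wt]; split.
  exists (a (+) par i j); rewrite (fd_pr_act _ _ (homog_delta _ i j)).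
  by rewrite -addbA addbb addbF va.
apply: torus_gen => b.
have [|c cE] := wt (delta_mx b b).
  rewrite inE; apply/is_diag_mxP => s t st; rewrite mxE.
  by case: andP => // -[/eqP sb /eqP tb]; rewrite sb tb eqxx in st.
exists (c + ((b == i)%:R - (b == j)%:R)).
by rewrite torus_swap cE (linZ (fd_act_linear _)) scalerDl.
Qed.

Lemma fobj_weight_span (M : Fg k m n) (U : {vspace M}) :
  (forall v : M, weightv v -> v \in U) -> U = fullv.
Proof.
move=> wU; have [r [W [sW _ sumW]]] := fobj_cr M.
apply/eqP; rewrite eqEsubv subvf -sumW; apply/subv_sumP => i _.
by have [X [XQ ->]] := simple_weight (sW i); apply/span_subvP => v /XQ/wU.
Qed.

(** Homogeneous weight vectors span [M], and [phi] and all matrix units send such vectors to such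
    vectors; hence they span the module generated by [phi], and complete reducibility applies to
    it. *)
Lemma projective_cover (M : Fg k m n) :
  exists (P : Fg k m n) (s : M -> P) (pi : P -> M),
    [/\ rel_projective P, shom glmn P M pi, shom (even_part glmn) M P s
      & cancel s pi].
Proof.
have [X [phi [pi [projX piP phiP piK gX]]]] := relative_cover char0 M.
suff crX : completely_reducible (even_part glmn) X by exists (Fobj crX), phi, pi.
apply: weight_completely_reducible => // U wU.
have [E [_ EQ QE]] := max_free (fun v : X => weightv v).
have EU : (<<E>> <= U)%VS by apply/span_subvP => v /EQ/wU.
suff Ef : <<E>>%VS = fullv by apply/eqP; rewrite eqEsubv subvf -Ef.
have [lphi pphi aphi] := phiP.
apply: gX.
  split=> [a v|x v _].
    apply: lin_span (pr_lin (fd_axiom X) a) _ v => v vE.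
    by apply: weightv_pr (EQ v vE) _; apply: memv_span.
  apply: lin_span (fd_act_linear x) _ v => v vE; rewrite fd_act_delta_sum.
  rewrite memv_suml // => i _; rewrite memv_suml // => j _; rewrite memvZ // QE //.
  by apply: weightv_act_delta; apply: EQ.
move=> u; have [|V VP] := @lin_vspace _ M (fun u => phi u \in <<E>>%VS).
  split=> [|c v w hv hw]; first by rewrite (lin0 lphi) mem0v.
  by rewrite lphi memvD ?memvZ.
apply/VP; rewrite (@fobj_weight_span M V) ?memvf // => v [[a va] wt].
apply/VP/QE; split; first by exists a; have := pphi a v; rewrite /= va.
move=> t ht; have [c cE] := wt t ht; exists c.
have := aphi t v; rewrite /= => <-; first by rewrite cE (linZ lphi).
by rewrite inE /= torus_even.
Qed.

Section Lift.
Variables (l : subsuper k m n) (ll : {subset l <= @glmn k m n}).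
Variables (P M : fdsupermod (@glmn k m n)) (s : M -> P) (pi : P -> M).
Hypotheses (piP : shom glmn P M pi) (sP : shom (even_part glmn) M P s).
Hypothesis sK : cancel s pi.

Let Pl : supermod l := restrict ll P.
Let Ml : supermod l := restrict ll M.

(** The even part of [l] lies in [g_0], so the [g_0]-section [s] splits the restricted sequence.
    This serves both for [g] itself and for [para]. *)
Lemma rel_exact_ker :
  exists (K : supermod l) (i : K -> Pl), @rel_exact _ _ _ l K Pl Ml i pi.
Proof.
have [lpi ppi api] := piP; have [ls ps as_] := sP.
pose K := lker (linfun pi).
have KP v : v \in K <-> pi v = 0.
  by rewrite memv_ker linfunEP //; split=> [/eqP|->].
pose i (w : subvs_of K) : Pl := vsval w.
have li : linear i by move=> c u v; rewrite /i linearP.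
have ii : injective i by move=> u v; apply: subvs_inj.
have imK v : v \in K -> exists w, i w = v by move=> vK; exists (Subvs vK).
have [a w|x w _|pr [act [ax iP]]] := transport li ii.
- apply/imK/KP; have := ppi a (i w); rewrite /= => ->.
  have /KP -> := subvsP w; exact: (lin0 (pr_lin (fd_axiom M) a)).
- apply/imK/KP; have := api x (i w) isT; rewrite /= => ->.
  have /KP -> := subvsP w; exact: (lin0 (fd_act_linear x)).
exists (fd_supermod (FdSupermod ax)), i; split; last first.
  exists s; split=> //; split=> // x v; rewrite inE => /andP[_ ex].
  by apply: as_; rewrite inE /= ex.
split=> //.
- by split=> // x v _; apply: api.
- by move=> v; exists (s v).
- move=> v; split=> [/KP/imK //|[u <-]]; exact/KP/subvsP.
Qed.

Lemma rel_projective_lift (Q : supermod l) (h : Q -> Ml) : rel_projective Q ->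
  shom l Q Ml h -> exists h' : Q -> Pl, shom l Q Pl h' /\ forall x, pi (h' x) = h x.
Proof.
move=> projQ hP; have [K [i ex]] := rel_exact_ker.
exact: projQ ex h hP.
Qed.

End Lift.

Section FactorsProj.
Variables (l : subsuper k m n) (r : {pred 'M[k]_(m + n)}).

Lemma factors_proj_comp (A B C D : fobj l r) (f : A -> B) (h : B -> C) (g : C -> D) :
  shom l A B f -> shom l C D g -> factors_proj h -> factors_proj (g \o h \o f).
Proof.
move=> fP gP [P [projP [u [v [uP vP hE]]]]]; exists P; split=> //.
exists (u \o f), (g \o v); split=> [||x /=]; last by rewrite hE.
- exact: shom_comp uP fP.
- exact: shom_comp gP vP.
Qed.

Lemma factors_proj_ext (A B : fobj l r) (h h' : A -> B) :
  h =1 h' -> factors_proj h -> factors_proj h'.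
Proof. by move=> /funext ->. Qed.

End FactorsProj.

(** Both maps lift through the same cover of [B], which replaces the direct sum of the two
    projectives. *)
Lemma factors_proj_add (A B : Fg k m n) (h h' : A -> B) :
  factors_proj h -> factors_proj h' -> factors_proj (fun x => h x + h' x).
Proof.
have [P [s [pi [projP piP sP sK]]]] := projective_cover B.
have [lpi _ _] := piP.
have lift (f : A -> B) : factors_proj f ->
    exists u : A -> P, shom glmn A P u /\ forall x, f x = pi (u x).
  move=> [Q [projQ [u [v [uP vP fE]]]]].
  have [w [wP wE]] := rel_projective_lift (ll := fun _ => id) piP sP sK projQ vP.
  exists (w \o u); split; last by move=> x; rewrite fE /= wE.
  exact: (@shom_comp _ _ _ glmn glmn A Q P w u).
move=> /lift[u [[lu pu au] uE]] /lift[u' [[lu' pu' au'] uE']].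
exists P; split=> //; exists (fun x => u x + u' x), pi; split=> //; last first.
  by move=> x; rewrite uE uE' (linD lpi).
split=> [c x y|a x|x v gx].
- by rewrite lu lu' scalerDr addrACA.
- by rewrite pu pu' -(linD (pr_lin (sm_axiom (fd_supermod P)) a)).
- by rewrite au // au' // -(linD (act_linear (Z := P) x)).
Qed.

Lemma stable_iso_trans (A B C : Fg k m n) :
  stable_iso A B -> stable_iso B C -> stable_iso A C.
Proof.
suff main (A' B' C' : Fg k m n) (f : A' -> B') (g : B' -> A') (f' : B' -> C')
    (g' : C' -> B') : shom glmn A' B' f -> shom glmn B' A' g ->
    @stable_eq _ _ _ _ _ A' A' (g \o f) id -> @stable_eq _ _ _ _ _ B' B' (g' \o f') id ->
    @stable_eq _ _ _ _ _ A' A' ((g \o g') \o (f' \o f)) id.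
  move=> [f [g [fP gP gf fg]]] [f' [g' [fP' gP' gf' fg']]].
  exists (f' \o f), (g \o g'); split.
  - exact: shom_comp fP' fP.
  - exact: shom_comp gP gP'.
  - exact: main.
  - exact: main.
move=> fP gP gf gf'; have [lg _ _] := gP.
(* [g g' f' f - id] is the sum of [g (g' f' - id) f] and [g f - id]. *)
have := factors_proj_add (factors_proj_comp fP gP gf') gf.
apply: factors_proj_ext => x /=.
by rewrite (linD lg) (linN lg) addrA subrK.
Qed.

Lemma stable_iso_sym (A B : Fg k m n) : stable_iso A B -> stable_iso B A.
Proof. by move=> [f [g [fP gP gf fg]]]; exists g, f. Qed.

(** Reflexivity of stable isomorphism needs the zero map to factor through some projective. *)
Lemma zero_object (l : subsuper k m n) (r : {pred 'M[k]_(m + n)}) :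
  exists Z : fobj l r, rel_projective Z.
Proof.
pose zpr (a : bool) (v : 'rV[k]_0) : 'rV[k]_0 := v.
pose zact (x : 'M[k]_(m + n)) (v : 'rV[k]_0) : 'rV[k]_0 := v.
have E (u v : 'rV[k]_0) : u = v by rewrite [u]thinmx0 [v]thinmx0.
have ax : smod_axiom l zpr zact.
  by split=> *; first [exact: E | move=> ? ? ?; exact: E].
have cr : completely_reducible r (FdSupermod ax).
  exists 0%N, (fun _ => 0%VS); split=> [[]//||].
    by apply/directv_sumP => -[].
  apply/eqP; rewrite eqEsubv subvf; apply/subvP => v _.
  by rewrite (E v 0) mem0v.
exists (Fobj cr) => M1 M2 M3 f g [[_ [lg _ _] _ _ _] _] h [lh _ _].
have H := sm_axiom M2.
exists (fun _ => 0); split; last first.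
  by move=> v; rewrite (lin0 lg) (E v 0) (lin0 lh).
split=> [c u v|a v|x v lx]; first by rewrite scaler0 addr0.
- by rewrite (lin0 (pr_lin H a)).
- by rewrite (lin0 (act_lin H lx)).
Qed.

Lemma stable_iso_refl (l : subsuper k m n) (r : {pred 'M[k]_(m + n)}) (A : fobj l r) :
  stable_iso A A.
Proof.
have idP : shom l A A id by split.
have idE : @stable_eq _ _ _ _ _ A A (id \o id) id.
  have [Z projZ] := zero_object l r; have H := sm_axiom Z.
  exists Z; split=> //; exists (fun _ => 0), (fun _ => 0); split.
  - split=> [c u v|a v|x v lx].
    + by rewrite scaler0 addr0.
    + by rewrite (lin0 (pr_lin H a)).
    + by rewrite (lin0 (act_lin H lx)).
  - have HA := sm_axiom (fd_supermod A); split=> [c u v|a v|x v lx].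
    + by rewrite scaler0 addr0.
    + by rewrite (lin0 (pr_lin HA a)).
    + by rewrite (lin0 (act_lin HA lx)).
  - by move=> x; rewrite /= subrr.
by exists id, id.
Qed.

Lemma stable_iso_res (M N : Fg k m n) : (0 < m)%N -> (0 < n)%N ->
  stable_iso (res M) (res N) -> stable_iso M N.
Proof.
move=> m0 n0 [f [g [fP gP gf fg]]].
have full (A B : fdsupermod (@glmn k m n)) (h : A -> B) :
    shom para (restrict (@para_sub k m n) A) (restrict (@para_sub k m n) B) h ->
    shom glmn A B h := @para_hom_full _ _ _ char0 A B h m0 n0.
have lift (A : Fg k m n) (h : A -> A) :
    @factors_proj _ _ _ _ _ (res A) (res A) h -> @factors_proj _ _ _ _ _ A A h.
  have [P [s [pi [projP piP sP sK]]]] := projective_cover A.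
  move=> [Q [projQ [u [v [uP vP hE]]]]].
  have [w [wP wE]] := rel_projective_lift (ll := @para_sub k m n) piP sP sK projQ vP.
  exists P; split=> //; exists (w \o u), pi; split=> // [|x]; last by rewrite hE /= wE.
  exact: full (shom_comp wP uP).
by exists f, g; split; [exact: full | exact: full | exact: lift | exact: lift].
Qed.

End StableCategory.

Theorem corollary4p4 (k : closedFieldType) (m n : nat) :
  [pchar k]%R =i pred0 -> 0 < m -> 0 < n ->
  forall M N : Fg k m n,
    T (stmod_class M) -> T (stmod_class N) ->
    stmod_class (res M) = stmod_class (res N) ->
    stmod_class M = stmod_class N.
Proof.
move=> char0 m0 n0 M N _ _ resMN.
have MN : stable_iso M N.
  apply: stable_iso_res => //.
  (* Equal classes are equal predicates, compared here at [res N]. *)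
  change (stmod_class (res M) (res N)); rewrite resMN; exact: stable_iso_refl.
apply: funext => X; apply: propext; split; apply: stable_iso_trans => //.
exact: stable_iso_sym.
Qed.
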